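(* Let $\alpha_1,\alpha_0>0$, let $\mathbf{X}=\{X_n:n\ge1\}$ be the Pólya sequence with values in $\{0,1\}$ and parameter $\alpha_1\delta_1+\alpha_0\delta_0$, and let $\eta$ be the a.s. limit of $\frac1n\sum_{i=1}^nX_i$. Let $n\ge1$ and let $\psi$ be a real-valued function on $\{0,1\}^n$. The following conditions are equivalent: 1. $\psi\in\Xi_n(\mathbf{X})$; 2. $\psi=k\phi$, where $k$ is a real constant and $\phi$ is the symmetric function on $\{0,1\}^n$ solving the triangular system $$\sum_{m=0}^a\binom nm\binom{n-m}{n-a}(-1)^{a-m}\phi(\mathbf{1}^m\mathbf{0}^{n-m})=c_{n,a},\qquad a=0,\ldots,n;$$ 3. there exists $Y\in L^2(\eta)$ such that $$\psi(\mathbf{X}_n)=\sum_{a=1}^n\theta^{(n,a)}\sum_{1\le j_1<\cdots<j_a\le n}\mathbb{E}(Y-\mathbb{E}(Y)\mid X_{j_1},\ldots,X_{j_a}),\qquad\mathbb{P}\text{-a.s.}$$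
   Context: The Pólya sequence on $\{0,1\}$ with parameter $\alpha=\alpha_1\delta_1+\alpha_0\delta_0$ is the sequence of $\{0,1\}$-valued random variables with $\mathbb{P}(X_1=a_1,\ldots,X_k=a_k)=\prod_{i=1}^k\frac{\alpha(\{a_i\})+\sum_{l=1}^{i-1}\mathbf{1}(a_l=a_i)}{\alpha_1+\alpha_0+i-1}$; $\eta$ has the Beta$(\alpha_1,\alpha_0)$ law and conditionally on $\eta$ the $X_i$ are i.i.d. Bernoulli($\eta$). Write $\mathbf{X}_n=(X_1,\ldots,X_n)$. $L^2(\eta)$ is the space of square-integrable functionals of $\eta$. $\Xi_n(\mathbf{X})$ is the class of symmetric functions $\phi$ on $\{0,1\}^n$ with $\mathbb{E}(\phi(\mathbf{X}_n)\mid\mathbf{X}_{n-1})=0$ a.s. (for $n=1$: $\mathbb{E}(\phi(X_1))=0$). $\mathbf{1}^m\mathbf{0}^{n-m}$ is the vector with $m$ ones followed by $n-m$ zeros. The constants $c_{n,a}$ are the coefficients of the modified Jacobi polynomial $J_n^{\alpha_1,\alpha_0}(x)=\sum_{a=0}^nc_{n,a}x^a$: $c_{n,a}=\sqrt{k_n(\alpha_1,\alpha_0)}\,g_{n,a}(\alpha_1+\alpha_0-1,\alpha_1)$ with $$g_{n,a}(p,q)=\binom na(-1)^{n-a}\frac{\Gamma(q+n)\Gamma(p+a+n)}{\Gamma(p+2n)\Gamma(a+q)},\quad k_n(\alpha_1,\alpha_0)=\frac{(2n+\alpha_1+\alpha_0-1)\Gamma^2(2n+\alpha_0+\alpha_1-1)}{n!\,\Gamma(n+\alpha_1)\Gamma(n+\alpha_0)\Gamma(n+\alpha_1+\alpha_0-1)}B(\alpha_1,\alpha_0),$$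 $B$ being the Beta function. Coefficients $\theta^{(k,a)}$: let $\alpha(A)=\alpha_1+\alpha_0$. Conventions: $(a)_{(b)}=a!/b!$ for integers $a\ge b\ge0$, empty products equal $1$, $\binom{a}{b}_*=\binom ab\mathbf{1}_{(a\ge b)}$. For $1\le m\le n$, $0\le r\le m$, $0\le p\le m-r$, $$\Phi(n,m,r,p)=(m-r)_{(m-r-p)}\frac{\prod_{s=1}^{m-(r+p)}[\alpha(A)+r+p+s-1]}{\prod_{s=1}^{m-r}[\alpha(A)+n+s-1]},$$ and for $1\le q\le m\le n\le N$, $\Psi_N(q,n,m)=\sum_{r=0}^q\binom qr\binom{N-n}{m-r}_*\Phi(n,m,r,q-r)$. For each $N\ge1$, the reals $\theta_N^{(k,a)}$ ($1\le a\le k\le N$) are defined recursively: for $k=1,\ldots,N-1$, $\theta_N^{(k,k)}=\Psi_N(k,k,k)^{-1}$ and $\sum_{i=q}^k\sum_{j=q}^i\theta_N^{(i,j)}\Psi_N(q,k,j)=0$ for $q=1,\ldots,k-1$; moreover $\theta_N^{(N,a)}=-\sum_{s=a}^{N-1}\theta_N^{(s,a)}$ for $1\le a\le N-1$ and $\theta_N^{(N,N)}=1$. Put $\theta_{N*}^{(k,a)}=\theta_N^{(k,a)}\binom{N-a}{k-a}^{-1}$ and $\theta^{(k,a)}=\lim_{N\to+\infty}\binom Nk\theta_{N*}^{(k,a)}$ (the limit exists). *)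

(* Defs.v *)
From HB Require Import structures.
From mathcomp Require Import all_boot all_order all_algebra perm.
From mathcomp Require Import all_classical all_reals all_analysis.
From mathcomp Require Import lra.

Set Implicit Arguments.
Unset Strict Implicit.
Unset Printing Implicit Defensive.

Import Order.TTheory GRing.Theory Num.Theory.
Import numFieldNormedType.Exports.

Local Open Scope classical_set_scope.
Local Open Scope ring_scope.

(** * Conditional expectation *)

Section conditional_expectation.
Context {d : measure_display} {T : measurableType d} {R : realType}.
Implicit Types P : probability T R.

(* Z is a version of E(Y | G), for a sub-sigma-algebra G of the
   sigma-algebra of T. *)
Definition is_cond_exp P (G : set (set T)) (Y Z : T -> R) : Prop :=
  [/\ forall B : set R, measurable B -> G (Z @^-1` B),
      P.-integrable setT (EFin \o Z) &
      forall A, G A ->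
        (\int[P]_(w in A) (Z w)%:E = \int[P]_(w in A) (Y w)%:E)%E].

(* The sigma-algebra generated by the family (X_j), j in J; it is trivial
   when J is empty. *)
Definition sigma_of (I : Type) (X : I -> T -> bool) (J : set I) :
    set (set T) :=
  <<s \bigcup_(j in J) preimage_set_system setT (X j) measurable >>.

(* L^2(eta): the square-integrable functionals of eta. *)
Definition L2_functional P (eta Y : T -> R) : Prop :=
  (exists2 f : R -> R, measurable_fun setT f & Y = f \o eta) /\
  Y \in Lfun P 2%:E.

End conditional_expectation.

(** * Polya sequences and symmetric functions on {0,1}^n *)

Section polya.
Context {d : measure_display} {T : measurableType d} {R : realType}.
Implicit Types (P : probability T R) (X : nat -> T -> bool).

(* Sequences are indexed from 0, so that X i stands for the (i+1)-st variable;
   hence the absence of the usual "- 1" in the denominator. *)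
Definition is_polya P X (al1 al0 : R) : Prop :=
  forall k (a : k.-tuple bool),
    P [set w | forall i : 'I_k, X i w = tnth a i] =
    (\prod_(i < k)
       (((if tnth a i then al1 else al0)
         + (\sum_(l < k | (l < i)%N) (tnth a l == tnth a i))%N%:R)
        / (al1 + al0 + i%:R)))%:E.

Definition first_vars X (n : nat) (w : T) : n.-tuple bool :=
  [tuple X i w | i < n].

Definition sym_fun (n : nat) (phi : n.-tuple bool -> R) : Prop :=
  forall (s : 'S_n) (x : n.-tuple bool),
    phi [tuple tnth x (s i) | i < n] = phi x.

(* For n = 1 the conditioning sigma-algebra is trivial and the condition reads
   E(phi(X_1)) = 0. *)
Definition Xi P X (n : nat) : set (n.-tuple bool -> R) :=
  [set phi | sym_fun phi /\
     is_cond_exp P (sigma_of X `I_n.-1)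
       (fun w => phi (first_vars X n w)) (cst 0)].

End polya.

Arguments Xi {d T R} P X n _.

Definition ones_zeros (n m : nat) : n.-tuple bool :=
  [tuple (i < m)%N | i < n].

(** * Modified Jacobi polynomials *)

Section jacobi.
Context {R : realType}.

Definition Gamma (x : R) : R :=
  (\int[lebesgue_measure]_(t in `]0, +oo[) (t `^ (x - 1) * expR (- t)))%R.

Definition Beta (x y : R) : R :=
  (\int[lebesgue_measure]_(t in `]0, 1[)
     (t `^ (x - 1) * (1 - t) `^ (y - 1)))%R.

Definition jacobi_g (n a : nat) (p q : R) : R :=
  'C(n, a)%:R * (-1) ^+ (n - a) *
  (Gamma (q + n%:R) * Gamma (p + a%:R + n%:R)
   / (Gamma (p + 2 * n%:R) * Gamma (a%:R + q))).

Definition jacobi_k (n : nat) (al1 al0 : R) : R :=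
  (2 * n%:R + al1 + al0 - 1) * Gamma (2 * n%:R + al0 + al1 - 1) ^+ 2
  / (n`!%:R * Gamma (n%:R + al1) * Gamma (n%:R + al0)
     * Gamma (n%:R + al1 + al0 - 1))
  * Beta al1 al0.

(* The coefficient of x^a in the n-th modified Jacobi polynomial. *)
Definition jacobi_coef (al1 al0 : R) (n a : nat) : R :=
  Num.sqrt (jacobi_k n al1 al0) * jacobi_g n a (al1 + al0 - 1) al1.

End jacobi.

(** * The coefficients theta *)

Section theta.
Context {R : realType}.
Variable A : R. (* total mass alpha_1 + alpha_0 *)

Definition Phi (n m r p : nat) : R :=
  ((m - r)`!%:R / (m - r - p)`!%:R) *
  ((\prod_(1 <= s < (m - (r + p)).+1) (A + r%:R + p%:R + s%:R - 1))
   / (\prod_(1 <= s < (m - r).+1) (A + n%:R + s%:R - 1))).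

Definition Psi (N q n m : nat) : R :=
  \sum_(0 <= r < q.+1)
    'C(q, r)%:R * 'C(N - n, m - r)%:R * Phi n m r (q - r).

(* Only the entries th k a with 1 <= a <= k <= N are constrained. *)
Definition theta_system (N : nat) (th : nat -> nat -> R) : Prop :=
  [/\ forall k, (1 <= k < N)%N ->
        th k k = (Psi N k k k)^-1 /\
        forall q, (1 <= q < k)%N ->
          \sum_(q <= i < k.+1) \sum_(q <= j < i.+1)
             th i j * Psi N q k j = 0,
      forall a, (1 <= a < N)%N -> th N a = - \sum_(a <= s < N) th s a &
      th N N = 1].

Definition theta_N (N : nat) : nat -> nat -> R :=
  xget (fun _ _ => 0) [set th | theta_system N th].

Definition theta_Nstar (N k a : nat) : R :=
  theta_N N k a / 'C(N - a, k - a)%:R.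

Definition theta (k a : nat) : R :=
  lim ((fun N : nat => 'C(N, k)%:R * theta_Nstar N k a) @ \oo).

(** The system is triangular, so its solution exists and is unique. *)

Hypothesis A0 : 0 < A.

Lemma Phi_gt0 n m r p : 0 < Phi n m r p.
Proof.
have pos (x : R) s : 0 <= x -> (1 <= s)%N -> 0 < A + x + s%:R - 1.
  by move=> x0 s1; have := A0; have : (1:R) <= s%:R; [rewrite ler1n|lra].
rewrite /Phi mulr_gt0 ?divr_gt0 ?ltr0n ?fact_gt0//.
- rewrite big_nat prodr_gt0// => s /andP[s1 _].
  by rewrite -(addrA A) -natrD pos.
- by rewrite big_nat prodr_gt0// => s /andP[s1 _]; rewrite pos.
Qed.

Lemma Psi_diag_gt0 N q n : 0 < Psi N q n q.
Proof.
rewrite /Psi big_nat_recr//= ltr_wpDl//.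
  apply: sumr_ge0 => r _; apply: mulr_ge0; last exact/ltW/Phi_gt0.
  exact: mulr_ge0.
by rewrite subnn bin0 binn !mul1r Phi_gt0.
Qed.

Lemma triangular_solvable (D : nat -> nat -> R) (C : nat -> R) (x : R) K :
    (forall q, D q q != 0) ->
  exists v : nat -> R, v K = x /\
    forall q, (q < K)%N -> \sum_(q <= j < K.+1) v j * D q j = C q.
Proof.
move=> D0.
suff H t : exists v : nat -> R, v K = x /\
    forall q, (K - t <= q < K)%N -> \sum_(q <= j < K.+1) v j * D q j = C q.
  have [v [vK vP]] := H K; exists v; split=> // q qK.
  by apply: vP; rewrite subnn.
elim: t => [|t [v [vK vP]]].
  by exists (fun=> x); split=> // q; rewrite subn0 => /andP[/leq_ltn_trans h /h]; rewrite ltnn.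
have [Kt|tK] := leqP K t.
  exists v; split=> // q /andP[_ qK]; apply: vP; rewrite qK andbT.
  by move: Kt; rewrite -subn_eq0 => /eqP ->.
set q0 := (K - t.+1)%N.
have q0K : (q0 < K)%N by rewrite /q0 ltn_subrL/= (leq_ltn_trans _ tK).
have q0E : (K - t = q0.+1)%N by rewrite /q0 subnSK.
pose y := (C q0 - \sum_(q0.+1 <= j < K.+1) v j * D q0 j) / D q0 q0.
exists (fun j => if j == q0 then y else v j); split.
  by rewrite gtn_eqF.
move=> q /andP[q0q qK]; move: q0q; rewrite leq_eqVlt => /predU1P[<-|q0q].
  rewrite big_ltn ?(ltnW (_ : q0 < K.+1)%N)// ?eqxx ?ltnS ?(ltnW q0K)//.
  rewrite (eq_big_nat _ _ (F2 := fun j => v j * D q0 j)); last first.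
    by move=> j /andP[q0j _]; rewrite gtn_eqF.
  by rewrite /y divfK// subrK.
rewrite -(vP q) ?q0E ?q0q//; apply: eq_big_nat => j /andP[qj _].
by rewrite gtn_eqF// (leq_trans q0q qj).
Qed.

Lemma theta_system_exists N : (0 < N)%N -> exists th, theta_system N th.
Proof.
move=> N0.
pose row (th : nat -> nat -> R) k := th k k = (Psi N k k k)^-1 /\
  forall q, (1 <= q < k)%N ->
    \sum_(q <= i < k.+1) \sum_(q <= j < i.+1) th i j * Psi N q k j = 0.
have row_ext th th' k :
    (forall i, (i <= k)%N -> th i = th' i) -> row th k -> row th' k.
  move=> e [r1 r2]; split; first by rewrite -e.
  move=> q qk; apply: (etrans _ (r2 q qk)).
  apply: eq_big_nat => i /andP[_ ik].
  by apply: eq_bigr => j _; rewrite e.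
have rows K : exists th, forall k, (k <= K)%N -> row th k.
  elim: K => [|K [th thP]].
    exists (fun _ _ => (Psi N 0 0 0)^-1) => k; rewrite leqn0 => /eqP ->.
    by split=> // q; rewrite ltn0 andbF.
  pose C q := - \sum_(q <= i < K.+1) \sum_(q <= j < i.+1)
    th i j * Psi N q K.+1 j.
  have [v [vK vP]] := @triangular_solvable (fun q => Psi N q K.+1) C
    (Psi N K.+1 K.+1 K.+1)^-1 K.+1 (fun q => lt0r_neq0 (Psi_diag_gt0 _ _ _)).
  exists (fun k => if k == K.+1 then v else th k) => k.
  rewrite leq_eqVlt => /predU1P[->|kK]; last first.
    apply: (row_ext th); last exact: thP.
    by move=> i ik; rewrite ltn_eqF// (leq_ltn_trans ik kK).
  split; first by rewrite eqxx.
  move=> q /andP[q1 qK]; rewrite big_nat_recr ?(ltnW qK)//= eqxx vP//.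
  rewrite /C; apply/eqP; rewrite subr_eq0; apply/eqP.
  by apply: eq_big_nat => i /andP[_ iK]; rewrite ltn_eqF.
have [th thP] := rows N.-1.
pose th' k a := if k == N then (if a == N then 1 else
  - \sum_(a <= s < N) th s a) else th k a.
exists th'; split.
- move=> k /andP[k1 kN]; apply: (row_ext th).
    move=> i ik; apply/funext => a.
    by rewrite /th' ltn_eqF// (leq_ltn_trans ik kN).
  by apply: thP; rewrite -ltnS prednK.
- move=> a /andP[a1 aN]; rewrite /th' eqxx ltn_eqF//; congr (- _).
  by apply: eq_big_nat => s /andP[_ sN]; rewrite ltn_eqF.
- by rewrite /th' !eqxx.
Qed.

Lemma theta_system_unique N th th' :
    theta_system N th -> theta_system N th' ->
  forall k a, (1 <= a <= k)%N -> (k <= N)%N -> th k a = th' k a.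
Proof.
move=> [r1 r2 r3] [s1 s2 s3].
have small k : (k < N)%N -> forall a, (1 <= a <= k)%N -> th k a = th' k a.
  elim/ltn_ind: k => k IHk kN a /andP[a1 ak].
  have k1 : (1 <= k)%N by exact: leq_trans a1 ak.
  have [rk rq] := r1 k (introT andP (conj k1 kN)).
  have [sk sq] := s1 k (introT andP (conj k1 kN)).
  move: a1; have [t] := ubnP (k - a)%N; elim: t a ak => // t IHt a ak kat a1.
  move: ak; rewrite leq_eqVlt => /predU1P[->|ak]; first by rewrite rk sk.
  have ak1 : (a < k.+1)%N by rewrite ltnS ltnW.
  have a1k : (1 <= a < k)%N by rewrite a1.
  have := etrans (rq a a1k) (esym (sq a a1k)).
  rewrite big_nat_recr ?(ltnW ak)//= [in RHS]big_nat_recr ?(ltnW ak)//=.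
  have -> : \sum_(a <= i < k) \sum_(a <= j < i.+1) th i j * Psi N a k j =
      \sum_(a <= i < k) \sum_(a <= j < i.+1) th' i j * Psi N a k j.
    apply: eq_big_nat => i /andP[ai ik]; apply: eq_big_nat => j /andP[aj ji].
    by rewrite IHk// ?(ltn_trans ik)// (leq_trans a1 aj).
  move=> /addrI; rewrite big_ltn// [in RHS]big_ltn//.
  have -> : \sum_(a.+1 <= j < k.+1) th k j * Psi N a k j =
      \sum_(a.+1 <= j < k.+1) th' k j * Psi N a k j.
    apply: eq_big_nat => j /andP[aj jk]; rewrite IHt ?(leq_trans a1 (ltnW aj))//.
    by apply: leq_trans (ltn_sub2l ak aj) _; rewrite -ltnS.
  by move=> /addIr /mulIf; apply; rewrite lt0r_neq0// Psi_diag_gt0.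
move=> k a /andP[a1 ak]; rewrite leq_eqVlt => /predU1P[kN|kN]; last first.
  by apply: small; rewrite // a1.
move: ak; rewrite kN leq_eqVlt => /predU1P[->|aN]; first by rewrite r3 s3.
rewrite r2 ?a1// s2 ?a1//; congr (- _); apply: eq_big_nat => s /andP[sa sN].
by apply: small; rewrite // a1.
Qed.

Lemma theta_NP N : (0 < N)%N -> theta_system N (theta_N N).
Proof. by move=> /theta_system_exists[th thP]; exact: (xgetI _ thP). Qed.

End theta.

(* Main.v *)
(** Each of the three conditions is equivalent to [Xi_rec]: psi is a function f
    of the number m of ones with
      (al1 + m) f(m+1) + (al0 + n-1-m) f(m) = 0   for m < n.
    For Xi_n this is the conditional expectation given X_1, ..., X_(n-1), and the
    solutions form a line. The left-hand side of the triangular system is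
    C(n,a) times the a-th difference of f at 0; these differences of the
    generating solution are evaluated by a Vandermonde induction and give the
    Jacobi coefficients up to a nonzero factor. For the third condition,
    passing to the limit in the system for theta_N gives
      theta^(n,a) = (-1)^(n-a) (A+a)_(n-1) (A+2n-1) / n!,   A = al1 + al0,
    where (x)_k is the rising factorial. As eta is a limit of symmetric averages,
    E(Y - E(Y) | j ones, l zeros) = w(j,l) depends on the counts only, and it
    satisfies (A+j+l) w(j,l) = (al1+j) w(j+1,l) + (al0+l) w(j,l+1). A suitable
    combination of these relations is the recurrence for the right-hand side of
    the third condition. Conversely Y = eta^n gives a nonzero solution. *)

Require Import Defs.
From HB Require Import structures.
From mathcomp Require Import all_boot all_order all_algebra perm.
From mathcomp Require Import all_classical all_reals all_analysis.
From mathcomp Require Import measurable_realfun.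
From mathcomp Require Import ring lra zify.

Set Implicit Arguments.
Unset Strict Implicit.
Unset Printing Implicit Defensive.

Import Order.TTheory GRing.Theory Num.Theory.
Import numFieldNormedType.Exports.

Local Open Scope classical_set_scope.
Local Open Scope ring_scope.

(** Every conditioning sigma-algebra is generated by finitely many 0-1 variables, and under the
    Polya law all its atoms have positive probability. Conditional expectations are therefore
    treated as integrals over atoms: a version is determined at every point, and an almost sure
    identity between functions of X_1, ..., X_n holds for all vectors. That integrals over a
    cylinder depend on its counts only is direct for functions of finite averages. It passes to
    bounded continuous functions of eta by dominated convergence, to the events eta > t by
    approximation, and to all integrable Borel functions of eta because these events generate the
    Borel sets. The constants of the Jacobi polynomial matter only through their dependence on a and
    through being nonzero, so of Gamma one needs the functional equation and positivity, and of Beta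
    only positivity. The choice Y = eta^n is made because a factor eta^n acts on pattern
    probabilities like n additional ones; this makes the value at m = 0 explicit, and one nonzero
    value is enough on a line of solutions. *)

(** * Rising factorials *)

Section rising.
Context {R : realFieldType}.
Implicit Types (a b : R) (m n k : nat).

Definition rising a n : R := \prod_(i < n) (a + i%:R).

Lemma rising0 a : rising a 0 = 1.
Proof. by rewrite /rising big_ord0. Qed.

Lemma risingSr a n : rising a n.+1 = rising a n * (a + n%:R).
Proof. by rewrite /rising big_ord_recr. Qed.

Lemma risingD a m n : rising a (m + n) = rising a m * rising (a + m%:R) n.
Proof.
elim: n => [|n IHn]; first by rewrite addn0 rising0 mulr1.
by rewrite addnS !risingSr IHn natrD addrA mulrA.
Qed.

Lemma risingSl a n : rising a n.+1 = a * rising (a + 1) n.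
Proof. by rewrite -add1n risingD /rising big_ord1 addr0. Qed.

Lemma rising_gt0 a n : 0 < a -> 0 < rising a n.
Proof. by move=> a0; apply: prodr_gt0 => i _; rewrite ltr_wpDr. Qed.

Lemma rising_neq0 a n : 0 < a -> rising a n != 0.
Proof. by move=> a0; rewrite gt_eqF// rising_gt0. Qed.

End rising.

(** * Forward differences at 0 *)

Section forward_difference.
Context {R : realFieldType}.
Implicit Types (f g : nat -> R) (x y z : R).

Definition fwd n f : R := \sum_(i < n.+1) 'C(n, i)%:R * (-1) ^+ (n - i) * f i.

Lemma fwd0 f : fwd 0 f = f 0.
Proof. by rewrite /fwd big_ord1 subn0 expr0 bin0 !mul1r. Qed.

Lemma eq_fwd n f g : (forall i, (i <= n)%N -> f i = g i) -> fwd n f = fwd n g.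
Proof. by move=> fg; apply: eq_bigr => i _; rewrite fg// -ltnS. Qed.

Lemma fwdZ n y f : fwd n (fun i => y * f i) = y * fwd n f.
Proof. by rewrite /fwd mulr_sumr; apply: eq_bigr => i _; ring. Qed.

Lemma fwdB n f g : fwd n (fun i => f i - g i) = fwd n f - fwd n g.
Proof. by rewrite /fwd -sumrB; apply: eq_bigr => i _; ring. Qed.

(** Pascal's rule. Each evaluation below is an induction through this identity, so only the effect
    of one difference on the given family has to be known. *)
Lemma fwdS n f : fwd n.+1 f = fwd n (fun i => f i.+1 - f i).
Proof.
rewrite fwdB /fwd big_ord_recl bin0 subn0 mul1r.
under eq_bigr => i _.
  rewrite lift0 binS subSS natrD !mulrDl.
  over.
rewrite big_split/= big_ord_recr/= bin_small// !mul0r addr0.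
rewrite [in X in _ - X]big_ord_recl bin0 subn0 mul1r opprD !addrA addrC.
rewrite !addrA; congr (_ + _); last first.
  rewrite -sumrN; apply: eq_bigr => i _; rewrite lift0.
  have -> : (n - i = (n - i.+1).+1)%N by rewrite subnSK.
  by rewrite exprS; ring.
by rewrite exprS mulN1r mulNr.
Qed.

(** The coefficient of f a in [fwd a f] is 1, so the system is unitriangular. *)
Lemma fwd_inj n f g : (forall a, (a <= n)%N -> fwd a f = fwd a g) ->
  forall a, (a <= n)%N -> f a = g a.
Proof.
move=> fg; elim/ltn_ind => a IH an; have := fg a an.
rewrite /fwd big_ord_recr [in RHS]big_ord_recr/= subnn binn !mul1r.
rewrite (eq_bigr (fun i : 'I_a => 'C(a, i)%:R * (-1) ^+ (a - i) * g i)).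
  exact: addrI.
by move=> i _; rewrite IH// (leq_trans (ltnW (ltn_ord i))).
Qed.

(* The value at m ones of the solution of the recurrence of Xi_n, for
   x = al0 + n - 1. *)
Definition alt_ratio (a x : R) m : R := \prod_(i < m) - ((x - i%:R) / (a + i%:R)).

(** This is the Chu-Vandermonde sum: [alt_ratio a x m] is (-x)_m / (a)_m. One difference turns the
    family for a into the family for a + 1, times -(a + x) / a, hence an induction on n with a
    general. *)
Lemma fwd_alt_ratio (a x : R) n : 0 < a ->
  fwd n (alt_ratio a x) = (-1) ^+ n * rising (a + x) n / rising a n.
Proof.
elim: n a => [|n IHn] a a0.
  by rewrite fwd0 /alt_ratio big_ord0 !rising0 expr0 mul1r divr1.
rewrite fwdS (@eq_fwd _ _ (fun i => - ((a + x) / a) * alt_ratio (a + 1) x i)).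
  rewrite fwdZ IHn ?ltr_wpDr// !risingSl exprS.
  rewrite (_ : a + x + 1 = a + 1 + x); last by ring.
  by field; rewrite rising_neq0 ?gt_eqF ?ltr_wpDr.
move=> i _; have H k : alt_ratio (a + 1) x k * (a + k%:R) = alt_ratio a x k * a.
  elim: k => [|k IHk]; first by rewrite /alt_ratio !big_ord0 addr0.
  rewrite /alt_ratio !big_ord_recr/= -!/(alt_ratio _ _ _).
  have ? : a + k%:R != 0 by rewrite gt_eqF// ltr_wpDr.
  have ? : a + 1 + k%:R != 0 by rewrite gt_eqF// ltr_wpDr// ltr_wpDr.
  rewrite -(mulfK (_ : a + k%:R != 0) (alt_ratio (a + 1) x k))// IHk -natr1.
  by field; repeat (apply/andP; split).
have ? : a + i%:R != 0 by rewrite gt_eqF// ltr_wpDr.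
rewrite [alt_ratio _ _ i.+1]big_ord_recr/= -/(alt_ratio _ _ _).
rewrite -(mulfK (_ : a + i%:R != 0) (alt_ratio (a + 1) x i))// H.
  by field; apply/andP; split=> //; rewrite gt_eqF.
Qed.

(** A polynomial of degree k < n is killed by n differences; concretely (y+1)_(k+1) - (y)_(k+1) =
    (k+1) (y+1)_k. *)
Lemma fwd_rising x n k : (k < n)%N -> fwd n (fun i => rising (x + i%:R) k) = 0.
Proof.
elim: n k x => // n IHn [|k] x kn.
  rewrite fwdS (@eq_fwd _ _ (fun i => 0 * i%:R)) ?fwdZ ?mul0r// => i _.
  by rewrite !rising0 subrr mul0r.
rewrite fwdS (@eq_fwd _ _ (fun i => k.+1%:R * rising (x + 1 + i%:R) k)).
  by rewrite fwdZ IHn ?mulr0.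
move=> i _; rewrite -natr1 risingSr [in X in _ - X]risingSl.
have -> : x + (i%:R + 1) = x + i%:R + 1 by ring.
have -> : x + 1 + i%:R = x + i%:R + 1 by ring.
by rewrite -natr1; ring.
Qed.

(** One difference gives 1/(y+1)_k - 1/(y)_k = -k / (y)_(k+1), which stays in the family with k
    raised by one. *)
Lemma fwd_rising_inv x n k : 0 < x ->
  fwd n (fun i => (rising (x + i%:R) k)^-1) =
  (-1) ^+ n * rising k%:R n / rising x (k + n).
Proof.
elim: n k => [|n IHn] k x0.
  by rewrite fwd0 addr0 rising0 expr0 !mul1r addn0.
rewrite fwdS (@eq_fwd _ _ (fun i => - k%:R * (rising (x + i%:R) k.+1)^-1)).
  rewrite fwdZ IHn// exprS risingSl natr1 addSnnS; ring.
move=> i _; have ? : 0 < x + i%:R by rewrite ltr_wpDr.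
rewrite -natr1 (_ : x + (i%:R + 1) = x + i%:R + 1); last by ring.
have := risingSl (x + i%:R) k; rewrite risingSr.
set u := rising _ k; set v := rising _ k => uv.
have u0 : u != 0 by rewrite rising_neq0.
have v0 : v != 0 by rewrite rising_neq0 ?ltr_wpDr.
have xk : x + i%:R + k%:R != 0 by rewrite gt_eqF ?ltr_wpDr.
have x0' : x + i%:R != 0 by rewrite gt_eqF.
have -> : v = u * (x + i%:R + k%:R) / (x + i%:R) by rewrite uv mulrC mulKf.
by field; repeat (apply/andP; split).
Qed.

End forward_difference.

(** * From the martingale relations to the recurrence in m *)

Section martingale_transform.
Context {R : realFieldType}.
Variables (al1 al0 : R) (w : nat -> nat -> R) (n : nat).
Let A := al1 + al0.

(** Up to a factor free of j and l, the right-hand side of condition 3 at a vector with m ones and M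
    zeros: the binomials count the index sets that meet j ones and l zeros. *)
Definition hoeffding_sum m M : R := \sum_(j < n.+1) \sum_(l < n.+1)
  'C(m, j)%:R * 'C(M, l)%:R * (-1) ^+ (j + l) * rising (A + (j + l)%:R) n.-1
  * w j l.

Hypothesis w_mart : forall j l,
  (A + (j + l)%:R) * w j l =
    (al1 + j%:R) * w j.+1 l + (al0 + l%:R) * w j l.+1.

(** The binomial coefficient with lower index i - 1, set to 0 at i = 0 so that Pascal's rule holds
    for every i. *)
Let pbin k i : R := if i is i'.+1 then 'C(k, i')%:R else 0.

Let sum_shift (u : nat -> R) k : u 0 = 0 -> u k = 0 ->
  \sum_(j < k) u j.+1 = \sum_(j < k) u j.
Proof.
move=> u0 uk; have : \sum_(j < k.+1) u j = \sum_(j < k) u j.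
  by rewrite big_ord_recr/= uk addr0.
by rewrite big_ord_recl u0 add0r => <-.
Qed.

(* The left-hand side is the combination of the relations [w_mart] with weights
   (-1)^(j+l) (A+j+l+1)_(n-1) C(m,j) C(M,l). *)
Lemma hoeffding_sum_rec m M : (0 < n)%N -> (m + M)%N = n.-1 ->
  (al1 + m%:R) * hoeffding_sum m.+1 M + (al0 + M%:R) * hoeffding_sum m M.+1 = 0.
Proof.
move=> n0 mM.
have mn : (m < n)%N by lia.
have Mn : (M < n)%N by lia.
pose e j l : R := (-1) ^+ (j + l) * rising (A + (j + l).+1%:R) n.-1.
pose b j l : R := 'C(m, j)%:R * 'C(M, l)%:R.
(* The terms in [w j.+1 l] and [w j l.+1] are shifted back to [w j l]. Nothing is lost at the ends:
   [u] and [v] vanish at index 0 by definition and at n + 1 because m and M are less than n. *)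
pose u j l : R := if j is j'.+1 then
  e j' l * b j' l * (al1 + j'%:R) * w j l else 0.
pose v j l : R := if l is l'.+1 then
  e j l' * b j l' * (al0 + l'%:R) * w j l else 0.
(* With s = j + l, (A+s) (A+s+1)_(n-1) = (A+s)_(n-1) (A+s+n-1): this restores the weights of
   [hoeffding_sum]. *)
have eE j l : e j l * (A + (j + l)%:R) =
    (-1) ^+ (j + l) * rising (A + (j + l)%:R) n.-1 * (A + (j + l)%:R + n.-1%:R).
  rewrite /e -[in RHS]mulrA -risingSr risingSl -natr1 addrA; ring.
have uE : \sum_(j < n.+1) \sum_(l < n.+1) u j.+1 l =
          \sum_(j < n.+1) \sum_(l < n.+1) u j l.
  apply: (sum_shift (u := fun j => \sum_(l < n.+1) u j l)).
    by rewrite big1.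
  by rewrite big1// => l _; rewrite /u /b bin_small// !(mul0r, mulr0).
have vE : \sum_(j < n.+1) \sum_(l < n.+1) v j l.+1 =
          \sum_(j < n.+1) \sum_(l < n.+1) v j l.
  apply: eq_bigr => j _; apply: sum_shift => //.
  by rewrite /v /b (@bin_small M)// !(mul0r, mulr0).
have : \sum_(j < n.+1) \sum_(l < n.+1) e j l * b j l *
    ((A + (j + l)%:R) * w j l - (al1 + j%:R) * w j.+1 l
     - (al0 + l%:R) * w j l.+1) = 0.
  apply: big1 => j _; apply: big1 => l _.
  by rewrite w_mart -addrA -opprD subrr mulr0.
have -> : \sum_(j < n.+1) \sum_(l < n.+1) e j l * b j l *
    ((A + (j + l)%:R) * w j l - (al1 + j%:R) * w j.+1 l
     - (al0 + l%:R) * w j l.+1) =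
  \sum_(j < n.+1) \sum_(l < n.+1)
     e j l * b j l * (A + (j + l)%:R) * w j l
  - \sum_(j < n.+1) \sum_(l < n.+1) u j.+1 l
  - \sum_(j < n.+1) \sum_(l < n.+1) v j l.+1.
  rewrite -!sumrB; apply: eq_bigr => j _; rewrite -!sumrB.
  by apply: eq_bigr => l _; rewrite /u /v; ring.
rewrite uE vE => <-; rewrite /hoeffding_sum !mulr_sumr -!sumrB -big_split/=.
apply: eq_bigr => j _; rewrite !mulr_sumr -!sumrB -big_split/=.
apply: eq_bigr => l _; rewrite {1}/b.
have binS k i : 'C(k.+1, i)%:R = 'C(k, i)%:R + pbin k i.
  by case: i => [|i]; rewrite /pbin ?bin0 ?addr0// binS natrD.
(* From (k-i+1) C(k,i-1) = i C(k,i). It trades the coefficients in m and M for coefficients in j and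
   l, so that the summands can be compared term by term. *)
have binM a k i : (a + k%:R) * pbin k i =
    (a + i%:R - 1) * pbin k i + i%:R * 'C(k, i)%:R.
  case: i => [|i]; rewrite /pbin ?mulr0 ?mul0r ?addr0//.
  have [ki|ik] := ltnP k i.
    by rewrite (bin_small ki) (bin_small (ltnW ki : k < i.+1)%N) !mulr0 addr0.
  rewrite -[in RHS]natrM mul_bin_left natrM natrB// -natr1; ring.
have uE' : u j l = - ((-1) ^+ (j + l) * rising (A + (j + l)%:R) n.-1 * pbin m j
    * 'C(M, l)%:R * (al1 + j%:R - 1) * w j l).
  case: (nat_of_ord j) => [|i]; rewrite /u /pbin /e /b ?mulr0 ?mul0r ?oppr0//.
  by rewrite addSn exprS -[i.+1%:R in RHS]natr1; ring.
have vE' : v j l = - ((-1) ^+ (j + l) * rising (A + (j + l)%:R) n.-1 * 'C(m, j)%:R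
    * pbin M l * (al0 + l%:R - 1) * w j l).
  case: (nat_of_ord l) => [|i]; rewrite /v /pbin /e /b ?mulr0 ?mul0r ?oppr0//.
  by rewrite addnS exprS -[i.+1%:R in RHS]natr1; ring.
rewrite uE' vE' !binS.
have -> : e j l * ('C(m, j)%:R * 'C(M, l)%:R) * (A + (j + l)%:R) * w j l =
  e j l * (A + (j + l)%:R) * 'C(m, j)%:R * 'C(M, l)%:R * w j l by ring.
rewrite eE.
set s := (-1) ^+ _; set r := rising _ _.
transitivity (s * r * w j l * (
   ((al1 + m%:R) + (al0 + M%:R)) * 'C(m, j)%:R * 'C(M, l)%:R
   + ((al1 + m%:R) * pbin m j) * 'C(M, l)%:R
   + ((al0 + M%:R) * pbin M l) * 'C(m, j)%:R)); first by ring.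
rewrite !binM -mM /A !natrD; ring.
Qed.

End martingale_transform.

(** * Sums over subsets, grouped by cardinality *)

Section subset_sums.
Context {R : realFieldType} (n : nat).
Implicit Types (S J : {set 'I_n}).

Lemma sum_subset_card S (g : nat -> R) :
  \sum_(J : {set 'I_n} | J \subset S) g #|J| =
  \sum_(j < n.+1) 'C(#|S|, j)%:R * g j.
Proof.
rewrite (partition_big (fun J => inord #|J| : 'I_n.+1) xpredT)//=.
apply: eq_bigr => j _.
rewrite -cards_draws -sum1_card natr_sum mulr_suml.
have cJ J : (#|J| < n.+1)%N by rewrite ltnS (leq_trans (max_card _))// card_ord.
apply: eq_big => J; first by rewrite inE -val_eqE/= inordK.
by move=> /andP[_ /eqP <-]; rewrite inordK// mul1r.
Qed.

(** A set J corresponds to the pair of its parts inside and outside S, which are chosen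
    independently. *)
Lemma sum_set_split S (G : nat -> nat -> R) :
  \sum_(J : {set 'I_n}) G #|J :&: S| #|J :\: S| =
  \sum_(j < n.+1) \sum_(l < n.+1)
     'C(#|S|, j)%:R * 'C(n - #|S|, l)%:R * G j l.
Proof.
pose h (p : {set 'I_n} * {set 'I_n}) := p.1 :|: p.2.
rewrite (reindex_onto h (fun J => (J :&: S, J :\: S))); last first.
  by move=> J _; rewrite /h/= finset.setID.
have condE (p : {set 'I_n} * {set 'I_n}) :
    ((h p :&: S, h p :\: S) == p) = (p.1 \subset S) && (p.2 \subset ~: S).
  case: p => B1 B2; rewrite /h xpair_eqE/=; apply/andP/andP.
    move=> [/eqP <- /eqP <-]; split; first exact: finset.subsetIr.
    by rewrite finset.setDE finset.subsetIr.
  move=> [B1S B2S]; have B2S0 : B2 :&: S = finset.set0.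
    by apply/eqP; rewrite finset.setI_eq0 finset.disjoints_subset.
  have B1S0 : B1 :\: S = finset.set0 by apply/eqP; rewrite finset.setD_eq0.
  rewrite finset.setIUl B2S0 finset.setU0 (finset.setIidPl B1S) finset.setDUl B1S0 finset.set0U.
  by rewrite finset.setDE (finset.setIidPl B2S).
transitivity (\sum_(p : {set 'I_n} * {set 'I_n} |
    (p.1 \subset S) && (p.2 \subset ~: S)) G #|p.1| #|p.2|).
  apply: eq_big => p; first by rewrite condE.
  by move=> /= /eqP pE; rewrite -[in RHS]pE.
rewrite -(pair_big (fun J => J \subset S) (fun J => J \subset ~: S)
  (fun B1 B2 => G #|B1| #|B2|))/=.
rewrite (sum_subset_card S (fun j => \sum_(J : {set 'I_n} | J \subset ~: S) G j #|J|)).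
apply: eq_bigr => j _; rewrite sum_subset_card mulr_sumr.
by apply: eq_bigr => l _; rewrite [#|~: S|]cardsCs finset.setCK card_ord mulrA.
Qed.

End subset_sums.

(** * Symmetric functions of 0-1 vectors *)

Section symmetric_functions.
Context {R : realType} (n : nat).

Definition tuple_ones (x : n.-tuple bool) : nat := \sum_(i < n) tnth x i.

Lemma tuple_ones_zeros m : (m <= n)%N -> tuple_ones (ones_zeros n m) = m.
Proof.
move=> mn; rewrite /tuple_ones /ones_zeros; under eq_bigr do rewrite tnth_mktuple.
have -> : (\sum_(i < n) (i < m)%N = \sum_(i < n | (i < m)%N) 1)%N.
  by rewrite [RHS]big_mkcond; apply: eq_bigr => i _; case: ltnP.
by rewrite -(big_ord_widen _ (fun=> 1)%N mn) sum1_card card_ord.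
Qed.

Lemma tuple_ones_leq x : (tuple_ones x <= n)%N.
Proof.
by rewrite -[leqRHS]card_ord -sum1_card; apply: leq_sum => i _; exact: leq_b1.
Qed.

Lemma count_tuple_ones (x : n.-tuple bool) : count_mem true x = tuple_ones x.
Proof.
rewrite -sum1_count big_tuple big_mkcond/=; apply: eq_bigr => i _.
by case: (tnth x i).
Qed.

Lemma sym_funP (phi : n.-tuple bool -> R) :
  sym_fun phi <-> forall x, phi x = phi (ones_zeros n (tuple_ones x)).
Proof.
split=> [sphi x|H s x]; last first.
  rewrite H [RHS]H; congr (phi (ones_zeros n _)).
  rewrite /tuple_ones [RHS](reindex_inj (@perm_inj _ s)).
  by apply: eq_bigr => i _; rewrite tnth_mktuple.
have /tuple_permP[s xE] : perm_eq x (ones_zeros n (tuple_ones x)).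
  have cT : count_mem true x = count_mem true (ones_zeros n (tuple_ones x)).
    by rewrite !count_tuple_ones tuple_ones_zeros ?tuple_ones_leq.
  apply/allP => -[] _; first exact/eqP.
  have F (y : n.-tuple bool) : (count_mem false y = n - count_mem true y)%N.
    rewrite -[X in (X - _)%N](size_tuple y) -(count_predC (pred1 true)) addKn.
    by apply: eq_count => -[].
  by apply/eqP; rewrite (F x) (F (ones_zeros _ _)) cT.
rewrite -(sphi s (ones_zeros n (tuple_ones x))); congr phi.
exact: val_inj.
Qed.

End symmetric_functions.

(** * The triangular system and the recurrence *)

Section jacobi_system.
Context {R : realType}.
Implicit Types (f : nat -> R).

(** Both sides are the multinomial coefficient for blocks of sizes m, a - m and n - a. *)
Lemma bin_mul_swap n m a : (m <= a <= n)%N ->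
  ('C(n, m) * 'C(n - m, n - a) = 'C(n, a) * 'C(a, m))%N.
Proof.
move=> /andP[ma an]; have mn := leq_trans ma an.
have p : (0 < m`! * (n - a)`! * (a - m)`!)%N by rewrite !muln_gt0 !fact_gt0.
apply/eqP; rewrite -(eqn_pmul2r p); apply/eqP.
have e1 := bin_fact mn; have e2 := bin_fact an; have e3 := bin_fact ma.
have e4 : ('C(n - m, n - a) * ((n - a)`! * (a - m)`!) = (n - m)`!)%N.
  have le : (n - a <= n - m)%N by lia.
  by rewrite -(bin_fact le); congr (_ * (_ * _`!))%N; lia.
transitivity (n`!).
  by rewrite -e1 -e4; ring.
by rewrite -e2 -e3; ring.
Qed.

Lemma sum_fwd n f a : (a <= n)%N ->
  \sum_(0 <= m < a.+1) 'C(n, m)%:R * 'C(n - m, n - a)%:R * (-1) ^+ (a - m) * f m =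
  'C(n, a)%:R * fwd a f.
Proof.
move=> an; rewrite big_mkord /fwd mulr_sumr; apply: eq_bigr => -[m /= ma] _.
rewrite /= -natrM bin_mul_swap ?natrM ?an ?andbT //; ring.
Qed.

Definition Xi_rec (al1 al0 : R) n f := forall m, (m < n)%N ->
  (al1 + m%:R) * f m.+1 + (al0 + (n.-1 - m)%:R) * f m = 0.

(** The coefficient al1 + m of f (m+1) is nonzero, so the value at 0 determines a solution; two
    solutions need only be compared there. *)
Lemma Xi_rec_alt_ratio al1 al0 n f : 0 < al1 -> Xi_rec al1 al0 n f ->
  forall m, (m <= n)%N -> f m = f 0 * alt_ratio al1 (al0 + n.-1%:R) m.
Proof.
move=> a1 rf; elim=> [|m IHm] mn; first by rewrite /alt_ratio big_ord0 mulr1.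
have am : al1 + m%:R != 0 by rewrite gt_eqF// ltr_wpDr.
have := rf m mn; rewrite addrC IHm 1?ltnW// => /addr0_eq E.
apply: (mulfI am); rewrite -E /alt_ratio big_ord_recr/= -/(alt_ratio _ _ _).
have -> : (n.-1 - m)%:R = n.-1%:R - m%:R :> R by rewrite natrB//; lia.
by field.
Qed.

Lemma alt_ratio_Xi_rec al1 al0 n : 0 < al1 ->
  Xi_rec al1 al0 n (alt_ratio al1 (al0 + n.-1%:R)).
Proof.
move=> a1 m mn; have am : al1 + m%:R != 0 by rewrite gt_eqF// ltr_wpDr.
rewrite /alt_ratio big_ord_recr/= -/(alt_ratio _ _ _).
have -> : (n.-1 - m)%:R = n.-1%:R - m%:R :> R by rewrite natrB//; lia.
by field.
Qed.

End jacobi_system.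

(** * Limits of sums and of normalised binomials *)

Section limits.
Context {R : realType}.

Lemma cvgr_sum_seq (I : Type) (s : seq I) (f : I -> nat -> R) (l : I -> R) :
  (forall i, f i @ \oo --> l i) ->
  (fun N => \sum_(i <- s) f i N) @ \oo --> \sum_(i <- s) l i.
Proof.
move=> fl; elim: s => [|i s IHs].
  by rewrite big_nil; under eq_fun do rewrite big_nil; exact: cvg_cst.
by rewrite big_cons; under eq_fun do rewrite big_cons; exact: cvgD.
Qed.

Lemma cvgr_sum_nat (a b : nat) (f : nat -> nat -> R) (l : nat -> R) :
  (forall i, (a <= i < b)%N -> f i @ \oo --> l i) ->
  (fun N => \sum_(a <= i < b) f i N) @ \oo --> \sum_(a <= i < b) l i.
Proof.
move=> fl; rewrite big_nat_cond big_mkcond/=.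
under eq_fun do rewrite big_nat_cond big_mkcond/=.
apply: (@cvgr_sum_seq _ _ (fun i N => if (a <= i < b)%N && true then f i N else 0)).
move=> i; rewrite andbT; case: ifPn => ab; first exact: fl.
exact: cvg_cst.
Qed.

Lemma cvgr_invn : (fun N : nat => N%:R^-1 : R) @ \oo --> (0 : R).
Proof.
apply/gtr0_cvgV0; last exact: cvgr_idn.
by near=> N; rewrite ltr0n; near: N; exact: nbhs_infty_gt.
Unshelve. all: by end_near. Qed.

Lemma cvgr_subn_ratio (k : nat) :
  (fun N : nat => (N - k)%:R / N%:R : R) @ \oo --> (1 : R).
Proof.
have : (fun N : nat => 1 - k%:R * N%:R^-1 : R) @ \oo --> (1 - k%:R * 0 : R).
  by apply: cvgB; [exact: cvg_cst|apply: cvgM; [exact: cvg_cst|exact: cvgr_invn]].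
rewrite mulr0 subr0; apply: cvg_trans; apply: near_eq_cvg; near=> N.
have kN : (k < N)%N by near: N; exact: nbhs_infty_gt.
rewrite natrB ?(ltnW kN)// mulrBl divff// pnatr_eq0.
by rewrite -lt0n (leq_ltn_trans _ kN).
Unshelve. all: by end_near. Qed.

(** Passing from i to i + 1 multiplies the quotient by (N-k-i) / (N (i+1)), which tends to 1 /
    (i+1). *)
Lemma cvgr_bin_ratio (k i : nat) :
  (fun N : nat => 'C(N - k, i)%:R / N%:R ^+ i : R) @ \oo --> (i`!%:R^-1 : R).
Proof.
elim: i => [|i IHi].
  under eq_fun do rewrite bin0 expr0 divr1.
  by rewrite fact0 invr1; exact: cvg_cst.
have -> : (fun N : nat => 'C(N - k, i.+1)%:R / N%:R ^+ i.+1 : R) =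
  (fun N : nat => 'C(N - k, i)%:R / N%:R ^+ i * ((N - (k + i))%:R / N%:R)
     * i.+1%:R^-1).
  apply/funext => N; rewrite exprSr invfM.
  have := mul_bin_left (N - k) i; rewrite -subnDA => /(congr1 (fun t => t%:R : R)).
  rewrite !natrM => E.
  have -> : 'C(N - k, i.+1)%:R = (N - (k + i))%:R * 'C(N - k, i)%:R / i.+1%:R :> R.
    by rewrite -E mulrC mulKf.
  ring.
have -> : i.+1`!%:R^-1 = i`!%:R^-1 * 1 * i.+1%:R^-1 :> R.
  by rewrite factS mulnC natrM invfM mulr1 mulrC.
apply: cvgM; last exact: cvg_cst.
by apply: cvgM => //; exact: cvgr_subn_ratio.
Qed.

End limits.

(** * Closed form of the limit coefficients theta *)

Section theta_closed_form.
Context {R : realType} (A : R) (A0 : 0 < A).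
Implicit Types (n k j q N : nat).

Lemma Phi0E k j q : (q <= j)%N ->
  Phi A k j 0 q = j`!%:R / (j - q)`!%:R *
    (rising (A + q%:R) (j - q) / rising (A + k%:R) j).
Proof.
have P x i : \prod_(1 <= s < i.+1) (x + s%:R - 1) = rising x i.
  rewrite big_add1 big_mkord; apply: eq_bigr => s _.
  by rewrite -natr1; ring.
by move=> qj; rewrite /Phi !subn0 add0n addr0 !P.
Qed.

(* The limit of N^j times the sum of the theta_N^(i,j) over j <= i <= k. In the
   limit the system reads sum_j u_j (A+q)_(j-q) / (j-q)! = [q = k] with
   u_j = S_lim k j / (A+k)_j, which binomial inversion solves. *)
Definition S_lim k j : R := (-1) ^+ (k - j) * rising (A + j%:R) k / (k - j)`!%:R.

(** Since (A+j)_k = (A+j)_(k-j) (A+k)_j, everything in a summand except (-1)^(k-j) C(k-q,j-q)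
    combines to a factor free of j. What remains is a difference of order k - q of the constant
    1. *)
Lemma S_lim_system k q : (q <= k)%N ->
  \sum_(q <= j < k.+1) S_lim k j * (Phi A k j 0 q / j`!%:R) = (q == k)%:R.
Proof.
move=> qk.
transitivity (rising (A + q%:R) (k - q) / (k - q)`!%:R * fwd (k - q) (fun=> 1)).
  rewrite /fwd mulr_sumr -{1}[q]add0n big_addn subSn// big_mkord.
  apply: eq_bigr => -[i/=]; rewrite ltnS => ik _.
  have qik : (i + q <= k)%N by lia.
  rewrite /S_lim Phi0E ?leq_addl// mulr1 addnK.
  have -> : (k - (i + q) = k - q - i)%N by lia.
  have kE : (k - q = i + (k - q - i))%N by lia.
  rewrite [in X in _ = X / _ * _]kE (risingD (A + q%:R) i).
  have -> : A + q%:R + i%:R = A + (i + q)%:R by rewrite natrD; ring.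
  have kE2 : k = (k - q - i + (i + q))%N by lia.
  have -> : rising (A + (i + q)%:R) k =
      rising (A + (i + q)%:R) (k - q - i) * rising (A + k%:R) (i + q).
    rewrite [in LHS]kE2 risingD; congr (_ * rising _ _).
    by rewrite -addrA -natrD; congr (_ + _%:R); lia.
  have <- := bin_fact ik; rewrite !natrM.
  have f0 x : x`!%:R != 0 :> R by rewrite pnatr_eq0 -lt0n fact_gt0.
  have b0 : 'C(k - q, i)%:R != 0 :> R by rewrite pnatr_eq0 -lt0n bin_gt0.
  field; rewrite !f0 b0 rising_neq0//; last by rewrite ltr_wpDr.
have [->|nqk] := eqVneq q k.
  by rewrite subnn rising0 fwd0 fact0 divr1 mulr1.
rewrite (_ : fwd _ _ = 0) ?mulr0//.
transitivity (fwd (k - q) (fun i => rising (A + i%:R) 0)).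
  by apply: eq_fwd => i _; rewrite rising0.
by rewrite fwd_rising// subn_gt0 ltn_neqAle nqk.
Qed.

(** The term of index r in [Psi] grows like N^(j-r), so only r = 0 survives division by N^j. *)
Lemma cvg_Psi k j q : (q <= j)%N ->
  (fun N => Psi A N q k j / N%:R ^+ j) @ \oo --> Phi A k j 0 q / j`!%:R.
Proof.
move=> qj.
have -> : (fun N : nat => Psi A N q k j / N%:R ^+ j) =
  (fun N : nat => \sum_(0 <= r < q.+1) ('C(q, r)%:R * Phi A k j r (q - r)) *
     ('C(N - k, j - r)%:R / N%:R ^+ (j - r) * (N%:R^-1 ^+ r))).
  apply/funext => N; rewrite /Psi mulr_suml; apply: eq_big_nat => r /andP[_ rq].
  have -> : (N%:R ^+ j)^-1 = (N%:R ^+ (j - r))^-1 * N%:R^-1 ^+ r :> R.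
    by rewrite exprVn -invfM -exprD subnK// (leq_trans _ qj).
  ring.
have -> : Phi A k j 0 q / j`!%:R = \sum_(0 <= r < q.+1)
   ('C(q, r)%:R * Phi A k j r (q - r)) * ((j - r)`!%:R^-1 * 0 ^+ r).
  rewrite big_nat_recl// big_nat big1; last by move=> i _; rewrite expr0n/= !mulr0.
  by rewrite bin0 !subn0 expr0 addr0 mulr1 mul1r.
apply: cvgr_sum_nat => r _; apply: cvgM; first exact: cvg_cst.
apply: cvgM; first exact: cvgr_bin_ratio.
elim: r => [|r IHr]; first by under eq_fun do rewrite expr0; exact: cvg_cst.
under eq_fun do rewrite exprS.
by rewrite exprS; apply: cvgM => //; exact: cvgr_invn.
Qed.

(** In the double sum of the system the factor [Psi] does not involve i. Summing over i first
    leaves, for fixed k, an ordinary triangular system in j, and [theta_N] is recovered as a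
    difference of two consecutive partial sums. *)
Definition theta_psum N k j : R := \sum_(j <= i < k.+1) theta_N A N i j.

Lemma theta_psum_diag N k : (1 <= k < N)%N -> theta_psum N k k = (Psi A N k k k)^-1.
Proof.
move=> kN; have N0 : (0 < N)%N by case/andP: kN => _; exact: leq_ltn_trans.
have [/(_ k kN)[+ _] _ _] := theta_NP A0 N0.
by rewrite /theta_psum big_nat1.
Qed.

Lemma theta_psum_system N k q : (1 <= q < k)%N -> (k < N)%N ->
  \sum_(q <= j < k.+1) theta_psum N k j * Psi A N q k j = 0.
Proof.
move=> /andP[q1 qk] kN; have N0 : (0 < N)%N by exact: leq_ltn_trans kN.
have k1N : (1 <= k < N)%N by rewrite kN andbT (leq_trans q1 (ltnW qk)).
have [/(_ k k1N)[_ /(_ q)] + _ _] := theta_NP A0 N0.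
rewrite q1 qk => /(_ isT) E; apply: etrans E.
under eq_bigr do rewrite /theta_psum mulr_suml.
transitivity (\sum_(q <= j < k.+1) \sum_(q <= i < k.+1 | (j <= i)%N)
    theta_N A N i j * Psi A N q k j).
  by apply: eq_big_nat => j /andP[qj _]; rewrite (big_nat_widenl _ q).
rewrite (exchange_big_dep_nat (fun=> true))//=.
apply: eq_big_nat => i /andP[qi ik].
by rewrite [RHS](big_nat_widen _ _ k.+1).
Qed.

(** Descending induction on j from the diagonal j = k: the equation of index q = j is solved for the
    unknown j, both for finite N and in the limit. *)
Lemma cvg_theta_psum k j : (1 <= j <= k)%N ->
  (fun N => N%:R ^+ j * theta_psum N k j) @ \oo --> S_lim k j.
Proof.
move=> /andP[]; have [t] := ubnP (k - j)%N.
elim: t j => // t IHt j kjt j1 jk.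
have nz q : Phi A k q 0 q / q`!%:R != 0.
  by rewrite gt_eqF// divr_gt0 ?Phi_gt0// ltr0n fact_gt0.
have [jkE|njk] := eqVneq j k.
  have E : S_lim k k * (Phi A k k 0 k / k`!%:R) = 1.
    by have := S_lim_system (leqnn k); rewrite big_nat1 eqxx.
  rewrite jkE (_ : S_lim k k = (Phi A k k 0 k / k`!%:R)^-1); last first.
    by apply: (mulIf (nz k)); rewrite E mulVf.
  have : (fun N => (Psi A N k k k / N%:R ^+ k)^-1) @ \oo -->
      (Phi A k k 0 k / k`!%:R)^-1 by apply: cvgV => //; exact: cvg_Psi.
  apply: cvg_trans; apply: near_eq_cvg; near=> N.
  rewrite theta_psum_diag ?invfM ?invrK 1?mulrC// -jkE j1/= jkE.
  by near: N; exact: nbhs_infty_gt.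
have jk' : (j < k)%N by rewrite ltn_neqAle njk.
have E := S_lim_system jk; rewrite (negbTE njk) big_ltn// in E.
have -> : S_lim k j = - (\sum_(j.+1 <= i < k.+1) S_lim k i * (Phi A k i 0 j / i`!%:R))
    / (Phi A k j 0 j / j`!%:R).
  by rewrite -(addr0_eq E) opprK mulfK.
(* The powers of N are inserted in cancelling pairs, so that each factor converges separately. *)
have : (fun N => - (\sum_(j.+1 <= i < k.+1) (N%:R ^+ i * theta_psum N k i) *
    (Psi A N j k i / N%:R ^+ i)) / (Psi A N j k j / N%:R ^+ j)) @ \oo -->
  - (\sum_(j.+1 <= i < k.+1) S_lim k i * (Phi A k i 0 j / i`!%:R))
    / (Phi A k j 0 j / j`!%:R).
  apply: cvgM; last by apply: cvgV => //; exact: cvg_Psi.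
  apply: cvgN; apply: cvgr_sum_nat => i /andP[ji ik].
  apply: cvgM; last by apply: cvg_Psi; exact: ltnW.
  by apply: IHt; lia.
apply: cvg_trans; apply: near_eq_cvg; near=> N.
have kN : (k < N)%N by near: N; exact: nbhs_infty_gt.
have N0 : N%:R != 0 :> R by rewrite pnatr_eq0 -lt0n (leq_ltn_trans _ kN).
have := @theta_psum_system N k j; rewrite j1 jk' => /(_ isT kN).
rewrite big_ltn// => /addr0_eq F.
have P0 : Psi A N j k j != 0 by rewrite gt_eqF ?Psi_diag_gt0.
rewrite (eq_bigr (fun i => theta_psum N k i * Psi A N j k i)); last first.
  by move=> i _; field; rewrite expf_neq0.
rewrite -F; field; rewrite P0 expf_neq0//.
Unshelve. all: by end_near. Qed.

(** The quotient of C(N,n) by C(N-a,n-a) behaves like N^a (n-a)! / n!, and N^a times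
    [theta_N A N n a] tends to the difference of [S_lim] at (n,a) and (n-1,a). *)
Lemma thetaE n a : (1 <= a <= n)%N -> theta A n a =
  (-1) ^+ (n - a) * rising (A + a%:R) n.-1 * (A + n%:R + n%:R - 1) / n`!%:R.
Proof.
move=> /andP[a1 an]; have n0 : (0 < n)%N by exact: leq_trans an.
rewrite /theta; apply/cvg_lim => //.
(* For a = n the second partial sum is empty, while [S_lim n.-1 n] is nonzero by truncated
   subtraction; hence the case distinction. *)
pose d N := N%:R ^+ a * theta_psum N n a
  - (if (a < n)%N then N%:R ^+ a * theta_psum N n.-1 a else 0).
pose dl := S_lim n a - (if (a < n)%N then S_lim n.-1 a else 0).
have dC : d @ \oo --> dl.
  apply: cvgB; first by apply: cvg_theta_psum; rewrite a1.
  case: ifPn => an'; last exact: cvg_cst.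
  by apply: cvg_theta_psum; rewrite a1 -ltnS prednK.
have -> : (-1) ^+ (n - a) * rising (A + a%:R) n.-1 * (A + n%:R + n%:R - 1) / n`!%:R
    = (n - a)`!%:R / n`!%:R * dl.
  have f0 x : x`!%:R != 0 :> R by rewrite pnatr_eq0 -lt0n fact_gt0.
  rewrite /dl /S_lim.
  have -> : rising (A + a%:R) n =
      rising (A + a%:R) n.-1 * (A + a%:R + n.-1%:R).
    by rewrite -{1}(prednK n0) risingSr.
  have nE : n%:R = n.-1%:R + 1 :> R by rewrite natr1 prednK.
  have [an'|] := ltnP a n; last first.
    move=> na; have -> : a = n by apply/eqP; rewrite eqn_leq an na.
    by rewrite subnn expr0 fact0 subr0 nE; field; rewrite f0.
  have -> : (n - a = (n.-1 - a).+1)%N by lia.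
  rewrite factS natrM exprS nE.
  have -> : (n.-1 - a).+1%:R = n.-1%:R - a%:R + 1 :> R.
    by rewrite -natr1 natrB//; lia.
  field; rewrite !f0 andbT.
  by rewrite -[_ - _ + 1]/(_) -natrB -?natr1 ?natr1 ?pnatr_eq0//; lia.
pose r N : R := 'C(N - 0, n)%:R / N%:R ^+ n /
  ('C(N - a, n - a)%:R / N%:R ^+ (n - a)).
have rC : r @ \oo --> ((n - a)`!%:R / n`!%:R : R).
  have f0 x : x`!%:R^-1 != 0 :> R by rewrite invr_neq0// pnatr_eq0 -lt0n fact_gt0.
  rewrite mulrC -[(n - a)`!%:R]invrK.
  apply: cvgM; first exact: cvgr_bin_ratio.
  by apply: cvgV => //; exact: cvgr_bin_ratio.
have : (fun N => r N * d N) @ \oo --> (n - a)`!%:R / n`!%:R * dl by exact: cvgM rC dC.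
apply: cvg_trans; apply: near_eq_cvg; near=> N.
have nN : (n < N)%N by near: N; exact: nbhs_infty_gt.
have N0 : N%:R != 0 :> R by rewrite pnatr_eq0 -lt0n (leq_ltn_trans _ nN).
rewrite /r /theta_Nstar subn0.
have -> : d N = N%:R ^+ a * theta_N A N n a.
  rewrite /d /theta_psum; case: ifPn => an'.
    by rewrite big_nat_recr//= prednK// mulrDr addrAC subrr add0r.
  have -> : n = a by apply/eqP; rewrite eqn_leq an andbT leqNgt.
  by rewrite big_nat1 subr0.
have -> : N%:R ^+ n = N%:R ^+ (n - a) * N%:R ^+ a :> R by rewrite -exprD subnK.
field; rewrite !expf_neq0// andbT pnatr_eq0 -lt0n bin_gt0; lia.
Unshelve. all: by end_near. Qed.

End theta_closed_form.

(** * Integration by parts on an increasing union of segments *)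

Section integration_by_parts_open.
Context {R : realType}.
Notation mu := (@lebesgue_measure R).
Variables (F u v : R -> R) (a b : nat -> R).
Let D := \bigcup_k `[a k, b k]%classic.
Hypotheses (ab : forall k, a k < b k)
  (a_noninc : forall k, a k.+1 <= a k) (b_nondec : forall k, b k <= b k.+1)
  (u0 : forall x, D x -> 0 <= u x) (v0 : forall x, D x -> 0 <= v x)
  (cu : forall x, D x -> {for x, continuous u})
  (cv : forall x, D x -> {for x, continuous v})
  (dF : forall x, D x -> is_derive x 1 F (u x - v x))
  (F0 : (fun k => F (b k) - F (a k)) @ \oo --> 0).

(** On each segment the fundamental theorem of calculus applies, and monotone convergence passes to
    the union. The boundary term is kept on the side of v, as the limit integrals may be infinite
    and cannot be subtracted. *)
Lemma ge0_integral_eq_by_parts :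
  (\int[mu]_(x in D) (u x)%:E = \int[mu]_(x in D) (v x)%:E)%E.
Proof.
have Dk k x : x \in `[a k, b k] -> D x by move=> xk; exists k.
have nd : nondecreasing_seq (fun k => `[a k, b k]%classic).
  apply/nondecreasing_seqP => k; apply/subsetPset => x /=.
  rewrite !in_itv/= => /andP[ax xb].
  by rewrite (le_trans (a_noninc k))//= (le_trans xb).
have within (w : R -> R) k : (forall x, D x -> {for x, continuous w}) ->
    {within `[a k, b k], continuous w}.
  move=> cw; apply: continuous_in_subspaceT => x; rewrite inE => xk.
  by apply: cw; exact: Dk xk.
have int (w : R -> R) k : (forall x, D x -> {for x, continuous w}) ->
    mu.-integrable `[a k, b k] (EFin \o w).
  move=> cw; apply: continuous_compact_integrable; first exact: segment_compact.
  exact: within.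
have cvg (w : R -> R) : (forall x, D x -> 0 <= w x) ->
    (forall x, D x -> {for x, continuous w}) ->
  (\int[mu]_(x in `[a k, b k]) (w x)%:E @[k --> \oo] -->
     \int[mu]_(x in D) (w x)%:E)%E.
  move=> w0 cw; apply: ge0_nondecreasing_set_cvg_integral => //.
  - by move=> k; exact: measurable_int (int w k cw).
  - by move=> k x xk; rewrite lee_fin w0//; exact: Dk xk.
have FTC k : (\int[mu]_(x in `[a k, b k]) (u x)%:E =
    \int[mu]_(x in `[a k, b k]) (v x)%:E + (F (b k) - F (a k))%:E)%E.
  have dFk x : x \in `[a k, b k] -> derivable F x 1.
    by move=> xk; have [] := dF (Dk _ _ xk).
  have E : (\int[mu]_(x in `[a k, b k]) (u x - v x)%:E = (F (b k))%:E - (F (a k))%:E)%E.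
    apply: continuous_FTC2 => //.
    - apply: within => x Dx; apply: cvgB; [exact: cu|exact: cv].
    - split.
      + by move=> x /subset_itv_oo_cc; exact: dFk.
      + apply: cvg_at_right_filter; apply: differentiable_continuous.
        by apply/derivable1_diffP/dFk; rewrite in_itv/= lexx ltW.
      + apply: cvg_at_left_filter; apply: differentiable_continuous.
        by apply/derivable1_diffP/dFk; rewrite in_itv/= lexx ltW.
    - move=> x /subset_itv_oo_cc xk; rewrite derive1E.
      by have [] := dF (Dk _ _ xk).
  have fv : (\int[mu]_(x in `[a k, b k]) (v x)%:E)%E \is a fin_num.
    by apply: integrable_fin_num => //; exact: int.
  have EB : (\int[mu]_(x in `[a k, b k]) (u x - v x)%:E =
      \int[mu]_(x in `[a k, b k]) (u x)%:E - \int[mu]_(x in `[a k, b k]) (v x)%:E)%E.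
    by rewrite -integralB_EFin//; [exact: int|exact: int].
  by rewrite EFinB -E EB addeC subeK.
have := cvg u u0 cu; under eq_fun do rewrite FTC.
move=> cvgu; have cvgv : (\int[mu]_(x in `[a k, b k]) (v x)%:E +
    (F (b k) - F (a k))%:E @[k --> \oo] --> \int[mu]_(x in D) (v x)%:E + 0)%E.
  apply: cvgeD; [by rewrite fin_num_adde_defl|exact: cvg|].
  by apply: cvg_EFin => //; apply: nearW.
rewrite -[RHS]adde0; exact: cvg_unique cvgu cvgv.
Qed.

End integration_by_parts_open.

(** * The Gamma function: finiteness, positivity, functional equation *)

Section gamma_function.
Context {R : realType}.
Notation mu := (@lebesgue_measure R).
Implicit Types x y t : R.

Definition gamma_pdf x t : R := t `^ (x - 1) * expR (- t).

(* With values in \bar R, the functional equation needs no integrability and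
   then yields finiteness. *)
Definition eGamma x : \bar R := (\int[mu]_(t in `]0%R, +oo[) (gamma_pdf x t)%:E)%E.

Lemma gamma_pdf_ge0 x t : 0 <= gamma_pdf x t.
Proof. by rewrite mulr_ge0// ?powR_ge0 ?expR_ge0. Qed.

Lemma measurable_gamma_pdf (D : set R) x :
  measurable_fun D (fun t : R => (gamma_pdf x t)%:E).
Proof.
apply/measurable_EFinP/measurable_funM.
  by apply: measurable_funTS; exact: measurable_powR.
by apply: measurable_funTS; apply: measurableT_comp.
Qed.

Lemma continuous_powR x t : 0 < t -> {for t, continuous (fun s : R => s `^ x)}.
Proof.
move=> t0; apply: differentiable_continuous; apply/derivable1_diffP.
by apply: derivable_powR; rewrite in_itv/= t0.
Qed.

Lemma continuous_gamma_pdf x t : 0 < t -> {for t, continuous (gamma_pdf x)}.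
Proof.
move=> t0; apply: cvgM; first exact: continuous_powR.
by apply: continuous_comp; [exact: oppr_continuous|exact: continuous_expR].
Qed.

Lemma itv0y_bigcup :
  `]0%R, +oo[%classic = \bigcup_k `[k.+1%:R^-1, k.+2%:R : R]%classic.
Proof.
apply/seteqP; split => t /=; rewrite in_itv/= ?andbT.
  move=> t0; pose k := maxn (Num.bound t) (Num.bound t^-1).
  exists k => //=; rewrite in_itv/=; apply/andP; split.
    rewrite -[leRHS]invrK lef_pV2 ?posrE ?invr_gt0// ltW//.
    apply: (lt_le_trans (archi_boundP _)); first by rewrite invr_ge0 ltW.
    by rewrite ler_nat; exact: leqW (leq_maxr _ _).
  rewrite ltW//; apply: (lt_le_trans (archi_boundP _)); first exact: ltW.
  by rewrite ler_nat; exact/leqW/leqW/leq_maxl.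
by move=> [k _]/=; rewrite in_itv/= => /andP[+ _]; apply: lt_le_trans.
Qed.

Lemma eGammaS x : 0 < x -> eGamma (x + 1) = (x%:E * eGamma x)%E.
Proof.
move=> x0; rewrite /eGamma.
rewrite -ge0_integralZl//; [|exact: measurable_gamma_pdf|
  by move=> t _; rewrite lee_fin gamma_pdf_ge0|by rewrite lee_fin ltW].
have Dpos t : (\bigcup_k `[k.+1%:R^-1, k.+2%:R : R]%classic) t -> 0 < t.
  by rewrite -itv0y_bigcup/= in_itv/= andbT.
rewrite itv0y_bigcup; under [in RHS]eq_integral do rewrite -EFinM.
(* The derivative of -t^x e^(-t) is t^x e^(-t) - x t^(x-1) e^(-t). *)
apply: (@ge0_integral_eq_by_parts _ (fun t => - (t `^ x * expR (- t)))
  (gamma_pdf (x + 1)) (fun t => x * gamma_pdf x t)).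
- move=> k; rewrite (@le_lt_trans _ _ 1)// ?invf_le1 ?ltr0n ?ltr1n// ler1n//.
- by move=> k; rewrite lef_pV2 ?posrE// ler_nat.
- by move=> k; rewrite ler_nat.
- by move=> t _; exact: gamma_pdf_ge0.
- by move=> t _; rewrite mulr_ge0 ?gamma_pdf_ge0 ?ltW.
- by move=> t /Dpos; exact: continuous_gamma_pdf.
- by move=> t /Dpos t0; apply: cvgM; [exact: cvg_cst|exact: continuous_gamma_pdf].
- move=> t /Dpos t0; rewrite /gamma_pdf addrK.
  have := is_derive1_powR x t0 => ?.
  by apply: is_derive_eq; rewrite /GRing.scale/=; ring.
rewrite -[X in _ --> X]subr0; apply: cvgB.
  rewrite -[X in _ --> X]oppr0; apply: cvgN.
  pose m := Num.bound x.
  have m1 : x <= m.+1%:R - 1.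
    by rewrite -natr1 addrK ltW// archi_boundP// ltW.
  (* For s = k + 2 and x <= m, the bound e^s >= s^(m+1) / (m+1)! gives s^x e^(-s) <= (m+1)! / s,
     which is at most (m+1)! / (k+1). *)
  apply: (@squeeze_cvgr _ _ _ _ (cst 0) (fun k : nat => m.+1`!%:R * k.+1%:R^-1)).
  - near=> k; have k0 : 0 < k.+2%:R :> R by [].
    rewrite /= mulr_ge0 ?powR_ge0 ?expR_ge0//= expRN.
    have E := expR_ge1Dxn m (ltW k0).
    rewrite ler_pdivrMr ?expR_gt0//.
    apply: (@le_trans _ _ (k.+2%:R ^+ m)).
      rewrite -powR_mulrn//; apply: ler_powR; first by rewrite ler1n.
      by rewrite (le_trans m1)// -natr1 addrK.
    apply: (@le_trans _ _ (m.+1`!%:R / k.+1%:R * (k.+2%:R ^+ m.+1 / m.+1`!%:R))).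
      have -> : m.+1`!%:R / k.+1%:R * (k.+2%:R ^+ m.+1 / m.+1`!%:R) =
          k.+2%:R ^+ m.+1 / k.+1%:R :> R.
        by field; rewrite nat1r !pnatr_eq0 -[_`! != 0]lt0n fact_gt0.
      by rewrite ler_pdivlMr// exprSr ler_wpM2l ?exprn_ge0// ler_nat.
    rewrite ler_wpM2l ?divr_ge0//; apply: le_trans E; rewrite lerDr//.
  - exact: cvg_cst.
  - rewrite -[X in _ --> X](mulr0 m.+1`!%:R); apply: cvgM; first exact: cvg_cst.
    exact: cvg_harmonic.
rewrite -[X in _ --> X]oppr0; apply: cvgN.
have H : (fun k : nat => k.+1%:R^-1 `^ x : R) @ \oo --> 0.
  have /cvg_at_rightP/(_ (fun k => k.+1%:R^-1)) := powR_cvg0 x0; apply.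
  by split; [move=> k; rewrite invr_gt0|exact: cvg_harmonic].
apply: (@squeeze_cvgr _ _ _ _ (cst 0) (fun k : nat => k.+1%:R^-1 `^ x));
  [|exact: cvg_cst|exact: H].
near=> k; rewrite mulr_ge0 ?powR_ge0 ?expR_ge0//= ler_piMr ?powR_ge0//.
Unshelve. all: by end_near. Qed.

Lemma integral_itv_gt0 (f : R -> R) (i : interval R) :
  measurable_fun [set` i] (fun t : R => (f t)%:E) ->
  (forall t, t \in i -> 0 < f t) -> (0 < mu [set` i])%E ->
  (0 < \int[mu]_(t in [set` i]) (f t)%:E)%E.
Proof.
move=> mf f0 i0; rewrite lt_neqAle; apply/andP; split; last first.
  by apply: integral_ge0 => t it; rewrite lee_fin ltW// f0.
apply/eqP => /esym If.
have : (\int[mu]_(t in [set` i]) `|(f t)%:E| = 0)%E.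
  rewrite -[RHS]If; apply: eq_integral => t; rewrite inE => it.
  by rewrite gee0_abs// lee_fin ltW// f0.
move/(ae_eq_integral_abs mu (measurable_itv i) mf).
move=> [N [mN N0 sN]]; have : (mu [set` i] <= mu N)%E.
  apply: le_measure; rewrite ?inE//.
  move=> t it; apply: sN => /= /(_ it) [] /eqP.
  by rewrite gt_eqF// f0.
by rewrite N0 leNgt i0.
Qed.

Lemma eGamma_gt0 x : (0 < eGamma x)%E.
Proof.
apply: integral_itv_gt0; first exact: measurable_gamma_pdf.
  by move=> t; rewrite in_itv/= andbT => t0; rewrite mulr_gt0 ?powR_gt0 ?expR_gt0.
rewrite lebesgue_measure_itv/=. by rewrite !ltry.
Qed.

Lemma eGamma1_fin : (eGamma 1 < +oo)%E.
Proof.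
apply: le_lt_trans (ltry 1); rewrite -(integral_exponential_pdf (@ltr01 R)).
rewrite /eGamma integral_mkcond; apply: ge0_le_integral => //.
- by move=> t _; apply: erestrict_ge0 => s _; rewrite lee_fin gamma_pdf_ge0.
- by apply/(measurable_restrictT _ _).1 => //; exact: measurable_gamma_pdf.
- by apply/measurable_EFinP; exact: measurable_exponential_pdf.
move=> t _; rewrite patchE; case: ifPn => [|_]; last first.
  by rewrite lee_fin exponential_pdf_ge0.
rewrite inE/= in_itv/= andbT => t0; rewrite exponential_pdfE ?(ltW t0)//.
by rewrite /gamma_pdf subrr powRr0 !mul1r mulN1r.
Qed.

(** Integers follow from the functional equation, y >= 1 from t^(y-1) <= 1 + t^m with an integer m
    >= y - 1, and small x by reading the functional equation backwards. *)
Lemma eGamma_fin x : 0 < x -> (eGamma x < +oo)%E.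
Proof.
have eGn n : (eGamma n.+1%:R < +oo)%E.
  elim: n => [|n IHn]; first exact: eGamma1_fin.
  by rewrite -natr1 eGammaS// lte_mul_pinfty// ?lee_fin.
suff G1 y : 1 <= y -> (eGamma y < +oo)%E.
  move=> x0; rewrite ltNge leye_eq; apply/negP => /eqP E.
  have : (eGamma (x + 1) < +oo)%E by apply: G1; rewrite lerDr ltW.
  by rewrite eGammaS// E gt0_muley ?lte_fin// ltxx.
move=> y1; pose m := Num.bound y.
apply: (@le_lt_trans _ _ (eGamma 1 + eGamma m.+1%:R)%E); last first.
  by rewrite lte_add_pinfty ?eGamma1_fin ?eGn.
rewrite /eGamma -ge0_integralD//; try exact: measurable_gamma_pdf;
  try by move=> t _; rewrite lee_fin gamma_pdf_ge0.
apply: ge0_le_integral => //; try exact: measurable_gamma_pdf;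
  try by move=> t _; rewrite -?EFinD lee_fin ?addr_ge0// gamma_pdf_ge0.
  by apply: emeasurable_funD; exact: measurable_gamma_pdf.
move=> t; rewrite /= in_itv/= andbT => t0; rewrite lee_fin -mulrDl.
rewrite ler_wpM2r ?expR_ge0// subrr powRr0.
have [t1|t1] := leP t 1.
  rewrite (@le_trans _ _ 1)// ?lerDl ?powR_ge0//.
  rewrite -[leRHS](powRr0 t); apply: ger_powR; first by rewrite t0.
  by rewrite subr_ge0.
rewrite (@le_trans _ _ (t `^ (m.+1%:R - 1)))// ?lerDr//.
apply: ler_powR; first exact: ltW.
rewrite lerD2r ltW// (lt_le_trans (archi_boundP _))// ?(le_trans _ y1)//.
by rewrite ler_nat.
Qed.

Lemma GammaE x : 0 < x -> (Gamma x)%:E = eGamma x.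
Proof.
move=> x0; rewrite /Gamma /Rintegral fineK// ge0_fin_numE ?eGamma_fin//.
exact/ltW/eGamma_gt0.
Qed.

Lemma Gamma_gt0 x : 0 < x -> 0 < Gamma x.
Proof. by move=> x0; rewrite -lte_fin GammaE// eGamma_gt0. Qed.

Lemma GammaS x : 0 < x -> Gamma (x + 1) = x * Gamma x.
Proof.
move=> x0; apply: EFin_inj; rewrite EFinM !GammaE ?eGammaS//.
by rewrite addr_gt0.
Qed.

Lemma Gamma_rising x n : 0 < x -> Gamma (x + n%:R) = rising x n * Gamma x.
Proof.
move=> x0; elim: n => [|n IHn]; first by rewrite addr0 rising0 mul1r.
by rewrite -natr1 addrA GammaS ?IHn ?risingSr ?ltr_wpDr//; ring.
Qed.

End gamma_function.

(** * The Beta function: finiteness and positivity *)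

Section beta_function.
Context {R : realType}.
Notation mu := (@lebesgue_measure R).
Implicit Types x y t : R.

Definition beta_integrand x y t : R := t `^ (x - 1) * (1 - t) `^ (y - 1).

Definition eBeta x y : \bar R :=
  (\int[mu]_(t in `]0%R, 1%R[) (beta_integrand x y t)%:E)%E.

Lemma beta_integrand_ge0 x y t : 0 <= beta_integrand x y t.
Proof. by rewrite mulr_ge0// powR_ge0. Qed.

Lemma measurable_beta_integrand (D : set R) x y :
  measurable_fun D (fun t : R => (beta_integrand x y t)%:E).
Proof.
apply/measurable_EFinP/measurable_funM.
  by apply: measurable_funTS; exact: measurable_powR.
apply: measurable_funTS.
apply: (@measurableT_comp _ _ _ _ _ _ (@powR R ^~ (y - 1))) => //.
exact: measurable_funB.
Qed.

Lemma continuous_beta_integrand x y t : 0 < t < 1 ->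
  {for t, continuous (beta_integrand x y)}.
Proof.
move=> /andP[t0 t1]; apply: cvgM; first exact: continuous_powR.
apply: (@continuous_comp _ _ _ (fun t => 1 - t) (fun s => s `^ (y - 1))).
  by apply: cvgB; [exact: cvg_cst|exact: cvg_id].
by apply: continuous_powR; rewrite subr_gt0.
Qed.

(** The denominators start at 3 so that the segments are nondegenerate from k = 0 on. *)
Lemma itv01_bigcup :
  `]0%R, 1%R[%classic = \bigcup_k `[k.+3%:R^-1, 1 - k.+3%:R^-1 : R]%classic.
Proof.
apply/seteqP; split => t /=; rewrite in_itv/=.
  move=> /andP[t0 t1]; pose k := maxn (Num.bound t^-1) (Num.bound (1 - t)^-1).
  have H (s : R) : 0 < s -> (Num.bound s^-1 <= k)%N -> k.+3%:R^-1 <= s.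
    move=> s0 sk; rewrite -[leRHS]invrK lef_pV2 ?posrE ?invr_gt0//.
    apply: ltW; apply: (lt_le_trans (archi_boundP _)); first by rewrite invr_ge0 ltW.
    by rewrite ler_nat; exact/leqW/leqW/leqW.
  exists k => //=; rewrite in_itv/=; apply/andP; split.
    by apply: H => //; exact: leq_maxl.
  by rewrite lerBrDr addrC -lerBrDr; apply: H; [rewrite subr_gt0|exact: leq_maxr].
move=> [k _]/=; rewrite in_itv/= => /andP[+ H].
move=> /(lt_le_trans _) -> //=.
by rewrite (le_lt_trans H)// ltrBlDr ltrDl invr_gt0.
Qed.

Lemma eBetaZ (c x y : R) : 0 <= c ->
  (c%:E * eBeta x y = \int[mu]_(t in `]0%R, 1%R[) (c * beta_integrand x y t)%:E)%E.
Proof.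
move=> c0; rewrite /eBeta -ge0_integralZl//; first exact: measurable_beta_integrand.
by move=> t _; rewrite lee_fin beta_integrand_ge0.
Qed.

Lemma powR_le1 (s z : R) : 0 <= s <= 1 -> 0 <= z -> s `^ z <= 1.
Proof.
move=> /andP[s0 s1] z0; have <- : 1 `^ z = 1 :> R by rewrite powR1.
by rewrite ge0_ler_powR// nnegrE.
Qed.

(** Integration by parts with the primitive t^x (1-t)^y, which vanishes at both ends. *)
Lemma eBeta_swap x y : 0 < x -> 0 < y ->
  (x%:E * eBeta x (y + 1) = y%:E * eBeta (x + 1) y)%E.
Proof.
move=> x0 y0; rewrite (eBetaZ _ _ (ltW x0)) (eBetaZ _ _ (ltW y0)).
have Dpos t : (\bigcup_k `[k.+3%:R^-1, 1 - k.+3%:R^-1 : R]%classic) t -> 0 < t < 1.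
  by rewrite -itv01_bigcup.
rewrite itv01_bigcup.
have inv3 k : k.+3%:R^-1 <= 3^-1 :> R by rewrite lef_pV2 ?posrE// ler_nat.
apply: (@ge0_integral_eq_by_parts _ (fun t => t `^ x * (1 - t) `^ y)
  (fun t => x * beta_integrand x (y + 1) t) (fun t => y * beta_integrand (x + 1) y t)).
- by move=> k; have := inv3 k; move: (k.+3%:R^-1) => z; lra.
- by move=> k; rewrite lef_pV2 ?posrE// ler_nat.
- by move=> k; rewrite lerD2l lerN2 lef_pV2 ?posrE// ler_nat.
- by move=> t _; rewrite mulr_ge0 ?beta_integrand_ge0 ?ltW.
- by move=> t _; rewrite mulr_ge0 ?beta_integrand_ge0 ?ltW.
- by move=> t /Dpos t0; apply: cvgM; [exact: cvg_cst|exact: continuous_beta_integrand].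
- by move=> t /Dpos t0; apply: cvgM; [exact: cvg_cst|exact: continuous_beta_integrand].
- move=> t /Dpos/andP[t0 t1]; rewrite /beta_integrand !addrK.
  have ? := is_derive1_powR x t0.
  have t1' : 0 < 1 - t by rewrite subr_gt0.
  have ? := is_derive1_powR y t1'.
  have ? : is_derive t 1 (fun s : R => (1 - s) `^ y) (y * (1 - t) `^ (y - 1) * (- 1)).
    apply: (@is_derive1_comp _ (fun s => s `^ y) (fun s : R => 1 - s)).
    by apply: is_derive_eq; rewrite add0r mul1r.
  by apply: is_derive_eq; rewrite /GRing.scale/=; ring.
have lim z : 0 < z -> (fun k : nat => k.+3%:R^-1 `^ z : R) @ \oo --> 0.
  move=> z0; have /cvg_at_rightP/(_ (fun k => k.+3%:R^-1)) := powR_cvg0 z0; apply.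
  split; first by move=> k; rewrite invr_gt0.
  have := @cvg_harmonic R; rewrite -(cvg_shiftn 2) /=.
  by under eq_fun do rewrite addn2.
rewrite -[X in _ --> X]subr0; apply: cvgB.
  apply: (@squeeze_cvgr _ _ _ _ (cst 0) (fun k : nat => k.+3%:R^-1 `^ y)).
  - near=> k; rewrite mulr_ge0 ?powR_ge0//= subKr ler_piMl ?powR_ge0// powR_le1// ?ltW//.
    have := inv3 k; have : 0 <= k.+3%:R^-1 :> R by [].
    by move: (k.+3%:R^-1) => z; lra.
  - exact: cvg_cst.
  - exact: lim.
apply: (@squeeze_cvgr _ _ _ _ (cst 0) (fun k : nat => k.+3%:R^-1 `^ x)).
- near=> k; rewrite mulr_ge0 ?powR_ge0//= ler_piMr ?powR_ge0// powR_le1// ?ltW//.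
  have := inv3 k; have : 0 <= k.+3%:R^-1 :> R by [].
  by move: (k.+3%:R^-1) => z; lra.
- exact: cvg_cst.
- exact: lim.
Unshelve. all: by end_near. Qed.

Lemma eBetaD x y : 0 < x -> 0 < y ->
  eBeta x y = (eBeta (x + 1) y + eBeta x (y + 1))%E.
Proof.
move=> x0 y0; rewrite /eBeta -ge0_integralD//; try exact: measurable_beta_integrand;
  try by move=> t _; rewrite lee_fin beta_integrand_ge0.
apply: eq_integral => t; rewrite inE/= in_itv/= => /andP[t0 t1].
rewrite -EFinD /beta_integrand !addrK; congr EFin.
rewrite -(@mulr_powRB1 _ t x) ?ltW// -(@mulr_powRB1 _ (1 - t) y)// ?subr_ge0 ?ltW//.
by ring.
Qed.

Lemma eBeta_gt0 x y : (0 < eBeta x y)%E.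
Proof.
apply: integral_itv_gt0; first exact: measurable_beta_integrand.
  move=> t; rewrite in_itv/= => /andP[t0 t1].
  by rewrite mulr_gt0// powR_gt0// subr_gt0.
by rewrite lebesgue_measure_itv/= lte_fin ltr01 oppr0 adde0 lte_fin.
Qed.

(** [Beta] is the [fine] part of this integral, which would be 0 at infinity, so its positivity
    rests on finiteness. With both parameters above 1 the integrand is at most 1; [eBetaD] and
    [eBeta_swap] then lower one parameter at a time. *)
Lemma eBeta_fin x y : 0 < x -> 0 < y -> (eBeta x y < +oo)%E.
Proof.
have fin_swap (c d : R) (I J : \bar R) : 0 < c -> 0 < d ->
    (c%:E * I = d%:E * J -> 0 <= I -> J < +oo -> I < +oo)%E.
  move=> c0 d0 E I0 Jy; rewrite ltNge leye_eq; apply/negP => /eqP Iy.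
  have : (d%:E * J < +oo)%E by rewrite lte_mul_pinfty// ?lee_fin ltW.
  by rewrite -E Iy gt0_muley ?lte_fin// ltxx.
have ge0 x' y' : (0 <= eBeta x' y')%E by exact/ltW/eBeta_gt0.
have fin11 x' y' : 0 < x' -> 0 < y' -> (eBeta (x' + 1) (y' + 1) < +oo)%E.
  move=> x0 y0; apply: (@le_lt_trans _ _ (\int[mu]_(t in `]0%R, 1%R[) (cst 1%:E) t)%E).
    apply: ge0_le_integral => //; try exact: measurable_beta_integrand.
      by move=> t _; rewrite lee_fin beta_integrand_ge0.
    move=> t; rewrite /= in_itv/= => /andP[t0 t1]; rewrite lee_fin /beta_integrand !addrK.
    by rewrite mulr_ile1 ?powR_ge0// powR_le1 ?subr_ge0 ?(ltW t0) ?(ltW t1)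
      ?gerBl ?(ltW x0) ?(ltW y0)// (ltW t0).
  rewrite integral_cst//= mul1e lebesgue_measure_itv/= lte_fin ltr01 oppr0 adde0. by rewrite ltry.
have fin21 x' y' : 0 < x' -> 0 < y' -> (eBeta (x' + 1) y' < +oo)%E.
  move=> x0 y0; have x10 : 0 < x' + 1 by rewrite addr_gt0.
  rewrite (eBetaD x10 y0) lte_add_pinfty ?(fin11 _ _ x0 y0)//.
  apply: (fin_swap _ _ _ _ y0 x10 (esym (eBeta_swap x10 y0)) (ge0 _ _)).
  exact: (fin11 _ _ x0 y0).
move=> x0 y0; rewrite (eBetaD x0 y0) lte_add_pinfty ?(fin21 _ _ x0 y0)//.
by apply: (fin_swap _ _ _ _ x0 y0 (eBeta_swap x0 y0) (ge0 _ _)); exact: (fin21 _ _ x0 y0).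
Qed.

Lemma Beta_gt0 x y : 0 < x -> 0 < y -> 0 < Beta x y.
Proof.
move=> x0 y0; apply: fine_gt0; apply/andP; split; first exact: eBeta_gt0.
exact: eBeta_fin.
Qed.

End beta_function.

(** * Conditional expectation given finitely many 0-1 variables *)

Section finite_cond_exp.
Context {d : measure_display} {T : measurableType d} {R : realType}.
Variables (P : probability T R) (I : eqType) (X : I -> T -> bool).
Hypothesis mX : forall i, measurable_fun setT (X i).
Implicit Types (s : seq I) (A B : set T) (c : I -> bool) (Y Z : T -> R).

Definition agree s w w' := forall i, i \in s -> X i w = X i w'.

(* For finite s these are the elements of the sigma-algebra of (X_i), i in s. *)
Definition saturated s A := forall w w', agree s w w' -> A w -> A w'.

Definition atom s c := [set w | forall i, i \in s -> X i w = c i].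

Lemma atom_saturated s c : saturated s (atom s c).
Proof. by move=> w w' ww' Aw i si; rewrite -ww'// Aw. Qed.

Lemma measurable_coord i b : measurable [set w | X i w = b].
Proof.
rewrite [X in measurable X](_ : _ = setT `&` X i @^-1` [set b]).
  exact: mX.
by rewrite setTI.
Qed.

Lemma sigma_of_coord s i b : i \in s -> sigma_of X [set` s] [set w | X i w = b].
Proof.
move=> si; apply: sub_sigma_algebra; exists i => //.
by exists [set b] => //; rewrite setTI.
Qed.

Lemma sigma_of_saturated s A : sigma_of X [set` s] A -> saturated s A.
Proof.
have sym w w' : agree s w w' -> agree s w' w by move=> ww' i si; rewrite ww'.
move: A; apply: smallest_sub.
- split=> [|A sA|F sF].
  + by [].
  + by move=> w w' ww' [_ nA]; split=> // Aw'; apply/nA/(sA w' w) => //; exact: sym.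
  + by move=> w w' ww' [k _ Fk]; exists k => //; exact: (sF k w w').
- move=> A [i /= si [B mB <-]] w w' ww' [_ /= Bw]; split=> //=.
  by rewrite -ww'.
Qed.

Lemma split_coord i A :
  A = (A `&` [set w | X i w = true]) `|` (A `&` [set w | X i w = false]).
Proof.
apply/seteqP; split=> w; last by move=> [[]|[]].
by case Xi: (X i w) => Aw; [left|right].
Qed.

Lemma disjoint_coord i A :
  [disjoint A `&` [set w | X i w = true] & A `&` [set w | X i w = false]].
Proof. by apply/disj_setPS => w [[_ /= ->] []]. Qed.

Lemma saturated_slice i s A b : saturated (i :: s) A ->
  exists2 B, saturated s B &
    A `&` [set w | X i w = b] = B `&` [set w | X i w = b].
Proof.
(* The slice of A is made independent of X_i by saturating it under agreement on s. *)
move=> sA; exists [set w | exists2 w', A w' & X i w' = b /\ agree s w' w].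
  move=> w w' ww' [u Au [ub uw]]; exists u => //; split=> // j sj.
  by rewrite uw// ww'.
apply/seteqP; split=> w [+ /= wb]; first by move=> Aw; split=> //; exists w.
move=> [u Au [ub uw]]; split=> //; apply: (sA u) => // j; rewrite inE.
by move=> /orP[/eqP->|/uw//]; rewrite ub wb.
Qed.

Lemma saturated_nil A : saturated [::] A -> A = setT \/ A = set0.
Proof.
move=> sA; have [[w Aw]|nA] := pselect (exists w, A w); [left|right].
  by apply/seteqP; split=> // w' _; exact: (sA w).
by apply/seteqP; split=> // w Aw; apply: nA; exists w.
Qed.

Lemma saturated_sigma_of s A : saturated s A -> sigma_of X [set` s] A.
Proof.
elim: s A => [|i s IHs] A sA.
  have [->|->] := saturated_nil sA.
    exact: (@measurableT _ (g_sigma_algebraType _)).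
  exact: (@measurable0 _ (g_sigma_algebraType _)).
have sub : sigma_of X [set` s] `<=` sigma_of X [set` i :: s].
  apply: sub_sigma_algebra2 => B [j /= sj Bj]; exists j => //=.
  by rewrite inE sj orbT.
have m b : sigma_of X [set` i :: s] (A `&` [set w | X i w = b]).
  have [B sB ->] := saturated_slice b sA.
  apply: (@measurableI _ (g_sigma_algebraType _)); first exact: (sub _ (IHs _ sB)).
  by apply: sigma_of_coord; rewrite mem_head.
rewrite (split_coord i A).
by apply: (@measurableU _ (g_sigma_algebraType _)); exact: m.
Qed.

Lemma measurable_sigma_of s A : sigma_of X [set` s] A -> measurable A.
Proof.
move: A; apply: smallest_sub; first exact: sigma_algebra_measurable.
by move=> A [i _ [B mB <-]]; exact: mX.
Qed.

Lemma measurable_saturated s A : saturated s A -> measurable A.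
Proof. by move=> /saturated_sigma_of/measurable_sigma_of. Qed.

Lemma measurable_atom s c : measurable (atom s c).
Proof. exact/measurable_saturated/atom_saturated. Qed.

(** The set [B] makes the induction on s go through: it accumulates the values prescribed to the
    coordinates already removed. *)
Lemma eq_integral_saturated s Y Z B : uniq s ->
  P.-integrable setT (EFin \o Y) -> P.-integrable setT (EFin \o Z) ->
  measurable B ->
  (forall c, \int[P]_(w in atom s c `&` B) (Z w)%:E =
             \int[P]_(w in atom s c `&` B) (Y w)%:E)%E ->
  forall A, saturated s A ->
    (\int[P]_(w in A `&` B) (Z w)%:E = \int[P]_(w in A `&` B) (Y w)%:E)%E.
Proof.
move=> + iY iZ; elim: s B => [|i s IHs] B.
  move=> _ mB H A /saturated_nil[]->; last by rewrite set0I !integral_set0.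
  have := H (fun=> true); rewrite (_ : atom [::] _ = setT)//.
  by apply/seteqP; split.
move=> /= /andP[si us] mB H A sA.
have mf Y' C : P.-integrable setT (EFin \o Y') ->
    measurable_fun C (fun w => (Y' w)%:E).
  by move=> /integrableP[mY' _]; exact: measurable_funTS.
have mi b : measurable (A `&` B `&` [set w | X i w = b]).
  apply: measurableI; last exact: measurable_coord.
  by apply: measurableI => //; exact: measurable_saturated sA.
rewrite (split_coord i (A `&` B)) !integral_setU//;
  try exact: disjoint_coord; try exact: mf.
suff K b : (\int[P]_(w in A `&` B `&` [set w | X i w = b]) (Z w)%:E =
    \int[P]_(w in A `&` B `&` [set w | X i w = b]) (Y w)%:E)%E by rewrite !K.
have [A' sA' AE] := saturated_slice b sA.
rewrite setIAC AE setIAC -setIA; apply: IHs => //.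
  by apply: measurableI => //; exact: measurable_coord.
(* As i is not in s, overwriting c at i leaves the atom over s unchanged. *)
move=> c; have := H (fun j => if j == i then b else c j).
suff -> : atom (i :: s) (fun j => if j == i then b else c j) =
    atom s c `&` [set w | X i w = b] by rewrite -setIA (setIC B).
apply/seteqP; split=> w /=.
  move=> Hw; split; last by have := Hw i; rewrite mem_head eqxx; exact.
  move=> j sj; have := Hw j; rewrite inE sj orbT => /(_ isT) ->.
  by case: eqP => // ji; rewrite -ji sj in si.
move=> [Hw Xi] j; rewrite inE; case: eqP => [->//|_] /=; exact: Hw.
Qed.

(** The preimage of the singleton of Z w is saturated, so Z is constant on atoms at every point and
    not merely almost surely. *)
Lemma is_cond_exp_atom s Y Z : is_cond_exp P (sigma_of X [set` s]) Y Z ->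
  (forall w w', agree s w w' -> Z w = Z w') /\
  (forall c, \int[P]_(w in atom s c) (Z w)%:E =
             \int[P]_(w in atom s c) (Y w)%:E)%E.
Proof.
move=> [ZG _ ZY]; split.
  move=> w w' ww'; apply: esym.
  exact: (sigma_of_saturated (ZG [set Z w] (measurable_set1 (Z w))) ww' erefl).
by move=> c; apply: ZY; apply: saturated_sigma_of; exact: atom_saturated.
Qed.

Lemma atom_is_cond_exp s Y Z : uniq s ->
  P.-integrable setT (EFin \o Y) -> P.-integrable setT (EFin \o Z) ->
  (forall w w', agree s w w' -> Z w = Z w') ->
  (forall c, \int[P]_(w in atom s c) (Z w)%:E =
             \int[P]_(w in atom s c) (Y w)%:E)%E ->
  is_cond_exp P (sigma_of X [set` s]) Y Z.
Proof.
move=> us iY iZ Zs ZY; split=> // [B mB|A /sigma_of_saturated sA].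
  by apply: saturated_sigma_of => w w' /Zs /= ->.
rewrite -(setIT A); apply: (eq_integral_saturated us) => // c.
by rewrite setIT.
Qed.

End finite_cond_exp.

(** * Cylinders and exchangeable integrals *)

Section cylinders.
Implicit Types (b : nat -> bool) (k : nat).

(** Patterns are functions on [nat] of which a prefix is read, so that a prefix can be lengthened
    without dependent types. *)
Definition ones b k : nat := \sum_(i < k) b i.

Definition upd b k v : nat -> bool := fun i => if i == k then v else b i.

Lemma ones_upd b k v : ones (upd b k v) k = ones b k.
Proof. by apply: eq_bigr => i _; rewrite /upd ltn_eqF. Qed.

Lemma ones_updS b k v : ones (upd b k v) k.+1 = (ones b k + v)%N.
Proof. by rewrite /ones big_ord_recr/= -/(ones (upd b k v) k) ones_upd /upd eqxx. Qed.

Lemma ones_leq b k : (ones b k <= k)%N.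
Proof.
rewrite -[leqRHS]card_ord -sum1_card; apply: leq_sum => i _.
exact: leq_b1.
Qed.

Lemma ones_ltn j k : ones (fun i => (i < j)%N) k = minn j k.
Proof.
elim: k => [|k IHk]; first by rewrite /ones big_ord0 minn0.
rewrite /ones big_ord_recr/= -/(ones (fun i => (i < j)%N) k) IHk; lia.
Qed.

End cylinders.

Section cylinder_integral.
Context {d : measure_display} {T : measurableType d} {R : realType}.
Variables (P : probability T R) (X : nat -> T -> bool).
Hypothesis mX : forall i, measurable_fun setT (X i).
Implicit Types (b : nat -> bool) (j k l r : nat) (f g Y : T -> R) (phi : R -> R).

Definition cyl b k := [set w | forall i, (i < k)%N -> X i w = b i].

Lemma cylS b k v : cyl (upd b k v) k.+1 = cyl b k `&` [set w | X k w = v].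
Proof.
apply/seteqP; split=> w /=.
  move=> H; split; last by rewrite H// /upd eqxx.
  by move=> i ik; rewrite H ?ltnS 1?ltnW// /upd ltn_eqF.
move=> [H Xk] i; rewrite ltnS leq_eqVlt => /predU1P[->|ik].
  by rewrite /upd eqxx.
by rewrite H// /upd ltn_eqF.
Qed.

Lemma measurable_cyl b k : measurable (cyl b k).
Proof.
rewrite (_ : cyl b k = atom X (iota 0 k) b); first exact: measurable_atom.
by apply/seteqP; split=> w H i; [rewrite mem_iota/= => /H|move=> ik; apply: H; rewrite mem_iota].
Qed.

Lemma integral_cylS b k f : measurable_fun setT f ->
  (\int[P]_(w in cyl b k) (f w)%:E =
   \int[P]_(w in cyl (upd b k true) k.+1) (f w)%:E +
   \int[P]_(w in cyl (upd b k false) k.+1) (f w)%:E)%E.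
Proof.
move=> mf; rewrite {1}(split_coord X k (cyl b k)) integral_setU ?cylS//.
- by apply: measurableI; [exact: measurable_cyl|exact: measurable_coord].
- by apply: measurableI; [exact: measurable_cyl|exact: measurable_coord].
- by apply: measurable_funTS; exact/measurable_EFinP.
- exact: disjoint_coord.
Qed.

Definition psum r w : R := \sum_(i < r) (X i w)%:R.

Lemma measurable_psum r : measurable_fun setT (psum r).
Proof.
apply: measurable_sum => i; apply: (@measurableT_comp _ _ _ _ _ _ (fun v : bool => v%:R : R)) => //.
Qed.

Lemma psum_cyl b k w : cyl b k w -> psum k w = (ones b k)%:R.
Proof. by move=> H; rewrite /ones natr_sum; apply: eq_bigr => i _; rewrite H. Qed.

Lemma psum_ge0 r w : 0 <= psum r w.
Proof. exact: sumr_ge0. Qed.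

Lemma psum_le r w : psum r w <= r%:R.
Proof.
rewrite -[r in leRHS]card_ord -sum1_card natr_sum; apply: ler_sum => i _.
by rewrite ler_nat leq_b1.
Qed.

Definition exchangeable Y (V : nat -> nat -> R) := forall b k,
  (\int[P]_(w in cyl b k) (Y w)%:E = (V (ones b k) (k - ones b k)%N)%:E)%E.

(** The next variable cuts a cylinder into two, with one more one or one more zero. *)
Lemma exchangeable_pascal Y V j l : measurable_fun setT Y -> exchangeable Y V ->
  V j l = V j.+1 l + V j l.+1.
Proof.
move=> mY YV; pose b i := (i < j)%N.
have oE : ones b (j + l) = j by rewrite ones_ltn; lia.
apply: EFin_inj; rewrite EFinD.
have := YV b (j + l)%N; rewrite oE addKn => <-.
rewrite integral_cylS// !YV !ones_updS oE addn1 addn0.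
by congr ((V _ _)%:E + (V _ _)%:E)%E; lia.
Qed.

(* Both sides are split along the values of X_k, ..., X_(k+r-1). *)
Lemma integral_psum_cyl Y V b k r : exchangeable Y V ->
  P.-integrable setT (EFin \o Y) ->
  (\int[P]_(w in cyl b k) (psum (k + r) w * Y w)%:E =
   ((ones b k)%:R * V (ones b k) (k - ones b k)%N
     + r%:R * V (ones b k).+1 (k - ones b k)%N)%:E)%E.
Proof.
move=> YV iY; have mY : measurable_fun setT Y.
  by have /integrableP[+ _] := iY => /measurable_EFinP.
elim: r b k => [|r IHr] b k.
  rewrite addn0 mul0r addr0 EFinM -YV -integralZl//; last first.
    by apply: integrableS iY => //; exact: measurable_cyl.
    exact: measurable_cyl.
  by apply: eq_integral => w; rewrite inE => /psum_cyl ->.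
rewrite integral_cylS; last first.
  by apply: measurable_funM => //; exact: measurable_psum.
rewrite -addSnnS !IHr !ones_updS addn1 addn0 -EFinD; congr EFin.
have ok := ones_leq b k; set o := ones b k in ok *.
have -> : (k.+1 - o.+1 = k - o)%N by lia.
have -> : (k.+1 - o = (k - o).+1)%N by lia.
rewrite (exchangeable_pascal o (k - o) mY YV).
rewrite (exchangeable_pascal o.+1 (k - o) mY YV) -!natr1; ring.
Qed.

Lemma exchangeableP Y : P.-integrable setT (EFin \o Y) ->
  (forall k b b', ones b k = ones b' k ->
    \int[P]_(w in cyl b k) (Y w)%:E = \int[P]_(w in cyl b' k) (Y w)%:E)%E ->
  exists V, exchangeable Y V.
Proof.
move=> iY H; exists (fun j l => fine
  (\int[P]_(w in cyl (fun i => (i < j)%N) (j + l)) (Y w)%:E)%E) => b k.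
rewrite fineK; last first.
  apply: integrable_fin_num; first exact: measurable_cyl.
  by apply: integrableS iY => //; exact: measurable_cyl.
rewrite subnKC ?ones_leq//; apply: H; rewrite ones_ltn.
by apply/esym/minn_idPl; exact: ones_leq.
Qed.

Variable V1 : nat -> nat -> R.
Hypothesis XV1 : exchangeable (fun=> 1) V1.

(** After r cuts the partial sum is constant on each piece, and the pieces of the two cylinders
    match with equal counts. *)
Lemma integral_fun_psum_cyl phi k r b b' : measurable_fun setT phi ->
  ones b k = ones b' k ->
  (\int[P]_(w in cyl b k) (phi (psum (k + r) w))%:E =
   \int[P]_(w in cyl b' k) (phi (psum (k + r) w))%:E)%E.
Proof.
move=> mphi; elim: r k b b' => [|r IHr] k b b' bb'.
  rewrite addn0.
  have E c : (\int[P]_(w in cyl c k) (phi (psum k w))%:E =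
      (phi (ones c k)%:R)%:E * (V1 (ones c k) (k - ones c k)%N)%:E)%E.
    rewrite -XV1 -integralZl//; last 2 first.
    - exact: measurable_cyl.
    - exact: (finite_measure_integrable_cst P 1 (measurable_cyl c k)).
    by apply: eq_integral => w; rewrite inE => /psum_cyl ->; rewrite mule1.
  by rewrite !E bb'.
have mphiS : measurable_fun setT (fun w => phi (psum (k + r.+1) w)).
  by apply: (@measurableT_comp _ _ _ _ _ _ phi) => //; exact: measurable_psum.
rewrite (integral_cylS b k mphiS) (integral_cylS b' k mphiS).
by rewrite -addSnnS; congr (_ + _)%E; apply: IHr; rewrite !ones_updS bb'.
Qed.

Variable eta : T -> R.
Hypothesis meta : measurable_fun setT eta.
Hypothesis X_eta : {ae P, forall w, (fun m => psum m w / m%:R) @ \oo --> eta w}.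

Lemma cvg_integral_fun_avg phi (M : R) k g (D : set T) : measurable D ->
  continuous phi -> (forall x, `|phi x| <= M) ->
  P.-integrable setT (EFin \o g) ->
  (\int[P]_(w in D) (phi (psum (k + r) w / (k + r)%:R) * g w)%:E @[r --> \oo]
    --> \int[P]_(w in D) (phi (eta w) * g w)%:E)%E.
Proof.
move=> mD cphi phiM ig.
have mphi : measurable_fun setT phi by exact: continuous_measurable_fun.
have mg : measurable_fun setT g.
  by have /integrableP[+ _] := ig => /measurable_EFinP.
have iMg : P.-integrable D (fun w => (M * `|g w|)%:E).
  have : P.-integrable D (EFin \o g) by exact: integrableS ig.
  move=> /integrable_norm /(integrableZl mD M).
  by apply: eq_integrable => // w _ /=; rewrite EFinM.
have M0 : 0 <= M by apply: le_trans (phiM 0).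
have [] // := @dominated_convergence _ _ _ P D mD
  (fun r w => (phi (psum (k + r) w / (k + r)%:R) * g w)%:E)
  (fun w => (phi (eta w) * g w)%:E) (fun w => (M * `|g w|)%:E).
- move=> r; apply/measurable_EFinP; apply: measurable_funM; last exact: measurable_funTS.
  apply: (@measurableT_comp _ _ _ _ _ _ phi) => //; apply: measurable_funTS.
  by apply: measurable_funM => //; exact: measurable_psum.
- apply/measurable_EFinP; apply: measurable_funM; last exact: measurable_funTS.
  by apply: (@measurableT_comp _ _ _ _ _ _ phi) => //; exact: measurable_funTS.
- apply: filterS X_eta => w Xw _; apply: cvg_EFin; first exact: nearW.
  apply: (@cvgM _ _ _ _ (fun r => phi (psum (k + r) w / (k + r)%:R)) (fun=> g w));
    last exact: cvg_cst.
  apply: continuous_cvg; first exact: cphi.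
  rewrite -(cvg_shiftn k) in Xw; apply: cvg_trans Xw.
  by under eq_cvg do rewrite addnC.
- by apply: aeW => w r _; rewrite lee_fin normrM ler_wpM2r.
Qed.

Lemma integral_fun_eta_cyl phi (M : R) k b b' :
  continuous phi -> (forall x, `|phi x| <= M) -> ones b k = ones b' k ->
  (\int[P]_(w in cyl b k) (phi (eta w))%:E =
   \int[P]_(w in cyl b' k) (phi (eta w))%:E)%E.
Proof.
move=> cphi phiM bb'.
have i1 : P.-integrable setT (EFin \o (fun=> 1 : R)).
  exact: finite_measure_integrable_cst.
have L c := cvg_integral_fun_avg k (measurable_cyl c k) cphi phiM i1.
have mphi : measurable_fun setT phi by exact: continuous_measurable_fun.
have := L b; under eq_cvg => r.
  under eq_integral do rewrite mulr1.
  rewrite (@integral_fun_psum_cyl (fun x => phi (x / (k + r)%:R)) k r b b')//; last first.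
    apply: (@measurableT_comp _ _ _ _ _ _ phi) => //.
    by apply: measurable_funM.
  over.
move=> Lb; have := L b'; under eq_cvg => r.
  under eq_integral do rewrite mulr1.
  over.
move=> Lb'; have := cvg_unique _ Lb Lb' => /(_ _)E.
under eq_integral do rewrite -[phi _]mulr1.
under [in RHS]eq_integral do rewrite -[phi _]mulr1.
exact: E.
Qed.

(* A continuous function with values in [0, 1] that increases with j to the
   indicator of ]t, +oo[; s - t + `|s - t| is twice the positive part of s - t. *)
Let step (t : R) (j : nat) (s : R) : R :=
  1 - (1 + (s - t + `|s - t|))^-1 ^+ j.

Let step_den (t s : R) : 1 <= 1 + (s - t + `|s - t|).
Proof. by have := ler_norm (- (s - t)); rewrite normrN; lra. Qed.

Let step_bound t j s : `|step t j s| <= 1.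
Proof.
have h := step_den t s; have h0 := lt_le_trans ltr01 h.
have p0 : 0 <= (1 + (s - t + `|s - t|))^-1 ^+ j.
  by rewrite exprn_ge0// invr_ge0 ltW.
have p1 : (1 + (s - t + `|s - t|))^-1 ^+ j <= 1.
  by rewrite exprn_ile1 ?invr_ge0 ?(ltW h0)// invf_le1.
rewrite ger0_norm /step; lra.
Qed.

Let step_continuous t j : continuous (step t j).
Proof.
move=> s; apply: cvgB; first exact: cvg_cst.
apply: (@continuous_comp _ _ _ (fun s => (1 + (s - t + `|s - t|))^-1)
  (fun x : R => x ^+ j)); last exact: exprn_continuous.
apply: cvgV; first by rewrite gt_eqF// (lt_le_trans ltr01 (step_den t s)).
have ct : (fun s : R => s - t) @ s --> s - t.
  by apply: cvgB; [exact: cvg_id|exact: cvg_cst].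
apply: cvgD; first exact: cvg_cst.
by apply: cvgD => //; exact: cvg_norm.
Qed.

Let step_cvg t s : step t j s @[j --> \oo] --> ((t < s)%R%:R : R).
Proof.
have [ts|st] := ltP t s; last first.
  rewrite /step ler0_norm ?subr_le0// subrr addr0 invr1.
  by under eq_cvg do rewrite expr1n subrr; exact: cvg_cst.
rewrite -[X in _ --> X]subr0; apply: cvgB; first exact: cvg_cst.
apply: cvg_expr; rewrite ger0_norm ?invr_ge0 ?(le_trans ler01 (step_den t s))//.
rewrite invf_lt1 ?(lt_le_trans ltr01 (step_den t s))// ltrDl.
by rewrite addr_gt0 ?normr_gt0 ?subr_eq0 ?gt_eqF// subr_gt0.
Qed.

(** The functions [step t j] are continuous and bounded by 1, so [integral_fun_eta_cyl] applies to
    each, and dominated convergence reaches the indicator. *)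
Lemma eta_tail_cyl t k b b' : ones b k = ones b' k ->
  P (cyl b k `&` eta @^-1` `]t, +oo[) = P (cyl b' k `&` eta @^-1` `]t, +oo[).
Proof.
move=> bb'.
have mB : measurable (eta @^-1` `]t, +oo[).
  by rewrite -[X in measurable X]setTI; exact: meta.
have L c : (\int[P]_(w in cyl c k) (step t j (eta w))%:E @[j --> \oo] -->
    P (cyl c k `&` eta @^-1` `]t, +oo[))%E.
  rewrite setIC -integral_indic//; last exact: measurable_cyl.
  have [] // := @dominated_convergence _ _ _ P (cyl c k) (measurable_cyl c k)
    (fun j w => (step t j (eta w))%:E)
    (fun w => (\1_(eta @^-1` `]t, +oo[) w)%:E) (cst 1%:E).
  - move=> j; apply/measurable_EFinP; apply: measurable_funTS.
    apply: (@measurableT_comp _ _ _ _ _ _ (step t j)) => //.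
    by apply: continuous_measurable_fun; exact: step_continuous.
  - apply/measurable_EFinP; exact: measurable_indic.
  - apply: aeW => w _; apply: cvg_EFin; first exact: nearW.
    have -> : \1_(eta @^-1` `]t, +oo[) w = (t < eta w)%R%:R :> R.
      rewrite indicE; congr (nat_of_bool _)%:R.
      by apply/idP/idP; rewrite inE /= in_itv/= andbT.
    exact: step_cvg.
  - exact: finite_measure_integrable_cst (measurable_cyl c k).
  - by apply: aeW => w j _; rewrite lee_fin; exact: step_bound.
have := L b; under eq_cvg => j.
  rewrite (integral_fun_eta_cyl (@step_continuous t j) (step_bound t j) bb').
  over.
by move=> /cvg_unique; apply => //; exact: L.
Qed.

End cylinder_integral.

(** * The law of eta on a restricted event *)

Section restriction_pushforward.
Context {d : measure_display} {T : measurableType d} {R : realType}.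
Variables (P : probability T R) (eta : T -> R).
Hypothesis meta : measurable_fun setT eta.

Lemma integral_mrestr (D : set T) (mD : measurable D) (f : T -> R) :
  measurable_fun setT f ->
  (\int[mrestr P mD]_w (f w)%:E = \int[P]_(w in D) (f w)%:E)%E.
Proof.
move=> mf; have mEf (A : set T) : measurable_fun A (fun w => (f w)%:E).
  by apply: measurable_funTS; exact/measurable_EFinP.
rewrite -(setUv D) integral_setU//; last 2 first.
- exact: measurableC.
- by apply/disj_setPS => w [].
rewrite [X in (_ + X)%E]null_set_integral ?adde0//; last 2 first.
- exact: measurableC.
- by rewrite /= /mrestr setICl measure0.
apply: eq_measure_integral => A mA AD.
by rewrite /= /mrestr (setIidl AD).
Qed.

(** The half-lines ]t, +oo[ are stable under intersection and generate the Borel sets, and those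
    with t = -k exhaust the line, so two finite measures equal on them coincide. *)
Lemma eq_borel_of_tails (D D' : set T) (mD : measurable D) (mD' : measurable D') :
  (forall t, P (D `&` eta @^-1` `]t, +oo[) = P (D' `&` eta @^-1` `]t, +oo[)) ->
  forall B : set R, measurable B -> P (D `&` eta @^-1` B) = P (D' `&` eta @^-1` B).
Proof.
move=> DD' B mB.
(* The generated name is the measure structure on the image by [eta] of [P] restricted to [E]. *)
pose m E (mE : measurable E) : {measure set R -> \bar R} :=
  measure_function_pushforward__canonical__measure_function_Measure
    (mrestr P mE) meta.
suff : m _ mD B = m _ mD' B.
  by rewrite /= /pushforward /mrestr setIC [X in _ = P X]setIC.
have H := @measure_unique _ R R (@RGenOInfty.G R)
  (fun k => `]- k%:R : R, +oo[%classic) (RGenOInfty.measurableE R) _ _ _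
  (m _ mD) (m _ mD').
apply: H => //.
- move=> _ _ [x ->] [y ->]; exists (Num.max x y).
  by apply/seteqP; split=> z /=; rewrite !in_itv/= !andbT gt_max => /andP.
- by move=> k; exists (- k%:R).
- apply/seteqP; split=> // x _; exists (Num.bound (- x)) => //=.
  rewrite in_itv/= andbT ltrNl; have [x0|x0] := leP 0 (- x).
    exact: archi_boundP.
  by rewrite (lt_le_trans x0).
- move=> _ [x ->]; rewrite /= /pushforward /mrestr setIC DD'.
  by rewrite setIC.
- move=> k; rewrite /= /pushforward /mrestr.
  rewrite (le_lt_trans _ (ltry 1))//; apply: probability_le1.
  by apply: measurableI => //; rewrite -[X in measurable X]setTI; exact: meta.
Qed.

Lemma eq_integral_of_tails (D D' : set T) (f : R -> R) :
  measurable D -> measurable D' -> measurable_fun setT f ->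
  P.-integrable setT (EFin \o (f \o eta)) ->
  (forall t, P (D `&` eta @^-1` `]t, +oo[) = P (D' `&` eta @^-1` `]t, +oo[)) ->
  (\int[P]_(w in D) (f (eta w))%:E = \int[P]_(w in D') (f (eta w))%:E)%E.
Proof.
move=> mD mD' mf iF DD'.
have mfe : measurable_fun setT (f \o eta) by exact: measurableT_comp.
have E C (mC : measurable C) : (\int[P]_(w in C) (f (eta w))%:E =
    \int[pushforward (mrestr P mC) eta]_x (f x)%:E)%E.
  rewrite -(integral_mrestr mC mfe) integral_pushforward//; first last.
  apply/integrableP; split; first exact/measurable_EFinP.
  have /integrableP[_] := integrableS measurableT mC (@subsetT _ C) iF.
  rewrite -(@integral_mrestr _ mC (fun w => `|f (eta w)|))//.
  by apply: measurableT_comp.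
  exact/measurable_EFinP.
by rewrite !E; apply: eq_measure_integral => A mA _;
  rewrite /= /pushforward /mrestr setIC (eq_borel_of_tails mD mD') 1?setIC.
Qed.

End restriction_pushforward.

(** * Pattern probabilities of the Polya sequence *)

Section polya_law.
Context {d : measure_display} {T : measurableType d} {R : realType}.
Variables (P : probability T R) (X : nat -> T -> bool) (al1 al0 : R).
Hypotheses (mX : forall i, measurable_fun setT (X i)).
Hypothesis polyaX : is_polya P X al1 al0.

(** The probability of one fixed pattern with j ones and l zeros, equal to the mixed moment of x^j
    (1-x)^l under the Beta law. *)
Definition polya_prob j l : R :=
  rising al1 j * rising al0 l / rising (al1 + al0) (j + l).

Lemma sum_eq_ones (b : nat -> bool) k v :
  (\sum_(l < k) (b l == v))%N = if v then ones b k else (k - ones b k)%N.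
Proof.
elim: k => [|k IHk]; first by rewrite /ones !big_ord0; case: v.
have ok := ones_leq b k.
have -> : ones b k.+1 = (ones b k + b k)%N by rewrite /ones big_ord_recr.
by rewrite big_ord_recr/= IHk; case: v {IHk}; case: (b k) => /=; lia.
Qed.

Lemma polya_prod (b : nat -> bool) k :
  \prod_(i < k) ((if b i then al1 else al0)
     + (\sum_(l < i) (b l == b i))%N%:R) =
  rising al1 (ones b k) * rising al0 (k - ones b k).
Proof.
elim: k => [|k IHk]; first by rewrite big_ord0 /ones big_ord0 !rising0 mulr1.
have ok := ones_leq b k.
have -> : ones b k.+1 = (ones b k + b k)%N by rewrite /ones big_ord_recr.
rewrite big_ord_recr/= IHk sum_eq_ones; case: (b k).
  by rewrite addn1 subSS risingSr; ring.
by rewrite addn0 subSn// risingSr; ring.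
Qed.

Lemma polya_exchangeable : exchangeable P X (fun=> 1) polya_prob.
Proof.
move=> b k; have ok := ones_leq b k.
rewrite -[LHS]/(\int[P]_(w in cyl X b k) (cst 1%E) w)%E.
rewrite integral_cst ?mul1e; last exact: measurable_cyl.
have -> : cyl X b k = [set w | forall i : 'I_k, X i w = tnth [tuple b i | i < k] i].
  apply/seteqP; split=> w /= H i; first by rewrite H ?tnth_mktuple.
  by move=> ik; rewrite (H (Ordinal ik)) tnth_mktuple.
apply: etrans (polyaX [tuple b i | i < k]) _; congr EFin; rewrite big_split/=.
rewrite /polya_prob subnKC// -polya_prod prodfV; congr (_ / _).
apply: eq_bigr => i _; rewrite tnth_mktuple; congr (_ + _%:R).
rewrite [RHS](big_ord_widen _ (fun l => nat_of_bool (b l == b i)) (ltnW (ltn_ord i))).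
by apply: eq_bigr => l _; rewrite tnth_mktuple.
Qed.

End polya_law.

Lemma probability_bounded_integrable (d : measure_display) (T : measurableType d)
    (R : realType) (P : probability T R) (f : T -> R) (M : R) :
  measurable_fun setT f -> (forall w, `|f w| <= M) ->
  P.-integrable setT (EFin \o f).
Proof.
move=> mf fM; apply: measurable_bounded_integrable => //.
  by rewrite (le_lt_trans (probability_le1 P measurableT))// ltry.
by exists M; split=> [|N MN w _ /=]; [exact: num_real|exact: le_trans (fM w) (ltW MN)].
Qed.

(** * Functionals of eta on cylinders *)

Section exchangeable_eta.
Context {d : measure_display} {T : measurableType d} {R : realType}.
Variables (P : probability T R) (X : nat -> T -> bool) (eta : T -> R).
Variable V1 : nat -> nat -> R.
Hypotheses (mX : forall i, measurable_fun setT (X i))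
  (meta : measurable_fun setT eta)
  (X_eta : {ae P, forall w, (fun m => psum X m w / m%:R) @ \oo --> eta w})
  (XV1 : exchangeable P X (fun=> 1) V1).

Lemma exchangeable_comp_eta (f : R -> R) : measurable_fun setT f ->
  P.-integrable setT (EFin \o (f \o eta)) ->
  exists V, exchangeable P X (f \o eta) V.
Proof.
move=> mf iF; apply: exchangeableP => // k b b' bb'.
apply: eq_integral_of_tails => //; [exact: measurable_cyl|exact: measurable_cyl|].
by move=> t; exact: (eta_tail_cyl mX XV1 meta X_eta).
Qed.

Lemma exchangeable_shift (Y : T -> R) (V : nat -> nat -> R) (c : R) :
  P.-integrable setT (EFin \o Y) -> exchangeable P X Y V ->
  exchangeable P X (fun w => Y w - c) (fun j l => V j l - c * V1 j l).
Proof.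
move=> iY YV b k; have mC := measurable_cyl mX b k.
have ic : P.-integrable (cyl X b k) (EFin \o (cst c)).
  exact: finite_measure_integrable_cst.
under eq_integral do rewrite EFinB.
rewrite (@integralB_EFin _ _ _ P _ Y (cst c))//; last exact: integrableS iY.
rewrite YV EFinB EFinM -XV1 -integralZl//; last first.
  exact: (finite_measure_integrable_cst P 1 mC).
by congr (_ - _)%E; apply: eq_integral => w _; rewrite mule1.
Qed.

(* The projection onto [0, 1]; it makes the powers of eta bounded everywhere and
   not only almost surely. *)
Definition clamp (x : R) : R := (1 + `|x| - `|1 - x|) / 2.

Lemma clamp_id x : 0 <= x <= 1 -> clamp x = x.
Proof.
by move=> /andP[x0 x1]; rewrite /clamp !ger0_norm ?subr_ge0//; field.
Qed.

Lemma clamp_itv x : 0 <= clamp x <= 1.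
Proof.
by rewrite /clamp; case: (ger0P x) => x0; case: (ger0P (1 - x)) => x1;
  apply/andP; split; lra.
Qed.

Lemma continuous_clamp : continuous clamp.
Proof.
move=> x; apply: cvgM; last exact: cvg_cst.
apply: cvgB; first by apply: cvgD; [exact: cvg_cst|apply: cvg_norm; exact: cvg_id].
by apply: cvg_norm; apply: cvgB; [exact: cvg_cst|exact: cvg_id].
Qed.

Lemma measurable_clampX r : measurable_fun setT (fun x : R => clamp x ^+ r).
Proof.
apply: continuous_measurable_fun => x.
apply: (@continuous_comp _ _ _ clamp (fun y : R => y ^+ r)).
  exact: continuous_clamp.
exact: exprn_continuous.
Qed.

Lemma clampX_itv r x : 0 <= clamp x ^+ r <= 1.
Proof. by have /andP[c0 c1] := clamp_itv x; rewrite exprn_ge0//= exprn_ile1. Qed.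

Lemma integrable_clampX r :
  P.-integrable setT (EFin \o (fun w => clamp (eta w) ^+ r)).
Proof.
apply: (@probability_bounded_integrable _ _ _ _ _ 1) => [|w].
  apply: (@measurableT_comp _ _ _ _ _ _ (fun x => clamp x ^+ r)) => //.
  exact: measurable_clampX.
by have /andP[c0 c1] := clampX_itv r (eta w); rewrite ger0_norm.
Qed.

(** A factor eta is the limit of averages, and [integral_psum_cyl] computes the integral against an
    average; in the limit one more one is recorded. Induction on r repeats this. *)
Lemma exchangeable_clampX r : exchangeable P X (fun w => clamp (eta w) ^+ r)
  (fun j l => V1 (j + r)%N l).
Proof.
elim: r => [|r IHr] b k.
  by under eq_integral do rewrite expr0; rewrite XV1 addn0.
have ok := ones_leq b k; set j := ones b k in ok *.
have clampM x : `|clamp x| <= 1.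
  by have /andP[c0 c1] := clamp_itv x; rewrite ger0_norm.
have L := cvg_integral_fun_avg mX meta X_eta k (measurable_cyl mX b k)
  continuous_clamp clampM (integrable_clampX r).
under eq_integral do rewrite exprS.
apply: (cvg_unique _ L) => //.
(* The integral with eta replaced by the average of the first k + i variables. Its first term
   vanishes in the limit, and i / (k + i) tends to 1. *)
pose u i : R := (k + i)%:R^-1 * (j%:R * V1 (j + r)%N (k - j)%N
   + i%:R * V1 (j.+1 + r)%N (k - j)%N).
have avg i w : (0 < k + i)%N -> clamp (psum X (k + i) w / (k + i)%:R) =
    psum X (k + i) w / (k + i)%:R.
  move=> ki; rewrite clamp_id// divr_ge0 ?psum_ge0//=.
  by rewrite ler_pdivrMr ?ltr0n// mul1r psum_le.
have ipsum i : P.-integrable (cyl X b k)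
    (EFin \o (fun w => psum X (k + i) w * clamp (eta w) ^+ r)).
  apply: (integrableS measurableT (measurable_cyl mX b k) (@subsetT _ _)).
  apply: (@probability_bounded_integrable _ _ _ _ _ (k + i)%:R) => [|w].
    apply: measurable_funM; first exact: measurable_psum.
    have /integrableP[+ _] := integrable_clampX r.
    exact: (measurable_EFinP _ _).1.
  have /andP[c0 c1] := clampX_itv r (eta w).
  rewrite ger0_norm ?mulr_ge0 ?psum_ge0// (le_trans (ler_piMr _ c1)) ?psum_ge0//.
  exact: psum_le.
have uE i : (0 < k + i)%N -> (u i)%:E =
    (\int[P]_(w in cyl X b k)
       (clamp (psum X (k + i) w / (k + i)%:R) * clamp (eta w) ^+ r)%:E)%E.
  move=> ki; rewrite /u EFinM -(integral_psum_cyl mX b k i IHr (integrable_clampX r)).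
  rewrite -integralZl//; [|exact: measurable_cyl|exact: ipsum].
  by apply: eq_integral => w _; rewrite -EFinM avg// mulrA (mulrC _^-1).
have ul : u @ \oo --> V1 (j.+1 + r)%N (k - j)%N.
  have -> : u = (fun i => (k + i)%:R^-1 * (j%:R * V1 (j + r)%N (k - j)%N)
      + (k + i - k)%:R / (k + i)%:R * V1 (j.+1 + r)%N (k - j)%N).
    by apply/funext => t; rewrite /u addKn; ring.
  have := @cvgr_subn_ratio R k; rewrite -(cvg_shiftn k) => r1.
  have := @cvgr_invn R; rewrite -(cvg_shiftn k) => r0.
  rewrite -[X in _ --> X]add0r -[X in _ --> X + _](mul0r (j%:R * V1 (j + r)%N (k - j)%N)).
  rewrite -[X in _ --> _ + X]mul1r.
  apply: cvgD.
    by apply: cvgM; [under eq_cvg do rewrite addnC; exact: r0|exact: cvg_cst].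
  by apply: cvgM; [under eq_cvg do rewrite addnC; exact: r1|exact: cvg_cst].
rewrite -addSnnS.
have : (fun i => (u i)%:E) @ \oo --> (V1 (j.+1 + r)%N (k - j)%N)%:E.
  by apply: cvg_EFin; first exact: nearW.
apply: cvg_trans; apply: near_eq_cvg; near=> i; rewrite uE//.
by rewrite addn_gt0; apply/orP; right; near: i; exact: nbhs_infty_gt.
Unshelve. all: by end_near. Qed.

End exchangeable_eta.

(** * Atoms over arbitrary sets of coordinates *)

Section subset_atoms.
Context {d : measure_display} {T : measurableType d} {R : realType}.
Variables (P : probability T R) (X : nat -> T -> bool) (n : nat).
Hypothesis mX : forall i, measurable_fun setT (X i).
Variables (Y : T -> R) (V : nat -> nat -> R).
Hypotheses (mY : measurable_fun setT Y) (YV : exchangeable P X Y V).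
Implicit Types (J : {set 'I_n}) (c : 'I_n -> bool).

Let Xn (i : 'I_n) := X i.

Definition ones_in J c : nat := \sum_(i in J) c i.

Lemma ones_in_leq J c : (ones_in J c <= #|J|)%N.
Proof. by rewrite -sum1_card; apply: leq_sum => i _; exact: leq_b1. Qed.

Lemma ones_in_setU1 J c i v : i \notin J ->
  ones_in (i |: J)%SET (fun j => if j == i then v else c j) = (ones_in J c + v)%N.
Proof.
move=> iJ; rewrite /ones_in big_setU1//= eqxx addnC; congr (_ + _)%N.
by apply: eq_bigr => j jJ; case: eqP => // ji; rewrite -ji jJ in iJ.
Qed.

(** Exchangeability is stated for prefixes only. Induction on the complement of J: a missing
    coordinate is added until the atom is a cylinder of length n, and the Pascal relation undoes the
    splitting. *)
Lemma integral_subset_atom J c :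
  (\int[P]_(w in atom Xn (enum J) c) (Y w)%:E =
   (V (ones_in J c) (#|J| - ones_in J c)%N)%:E)%E.
Proof.
have mEY D : measurable_fun D (fun w => (Y w)%:E).
  by apply: measurable_funTS; exact/measurable_EFinP.
have [t] := ubnP #|(~: J)%SET|; elim: t J c => // t IHt J c Jt.
have [J0|[i]] := set_0Vmem (~: J)%SET.
  have {Jt J0}-> : J = finset.setT by rewrite -[J]finset.setCK J0 finset.setC0.
  pose b k := if insub k is Some i then c i else false.
  have bE (i : 'I_n) : b i = c i by rewrite /b valK.
  have -> : atom Xn (enum (finset.setT : {set 'I_n})) c = cyl X b n.
    apply/seteqP; split=> w H i; last by move=> _; rewrite /Xn H// bE.
    by move=> ik; rewrite -[i]/(nat_of_ord (Ordinal ik)) bE -H// mem_enum finset.in_setT.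
  rewrite YV cardsT card_ord.
  have -> // : ones b n = ones_in finset.setT c.
  rewrite /ones_in /ones; apply: eq_big => i; first by rewrite finset.in_setT.
  by rewrite bE.
rewrite finset.in_setC => iJ.
have mXn : forall i, measurable_fun setT (Xn i) by move=> ?; exact: mX.
rewrite (split_coord Xn i (atom _ _ _)) integral_setU//; last 3 first.
- by apply: measurableI; [exact: measurable_atom|exact: measurable_coord].
- by apply: measurableI; [exact: measurable_atom|exact: measurable_coord].
- exact: disjoint_coord.
have aE v : atom Xn (enum J) c `&` [set w | Xn i w = v] =
    atom Xn (enum (i |: J)%SET) (fun j => if j == i then v else c j).
  apply/seteqP; split=> w /=.
    move=> [H Xi] j; rewrite mem_enum !inE; case: eqP => [->//|_ /=] jJ.
    by apply: H; rewrite mem_enum.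
  move=> H; split; last by have := H i; rewrite mem_enum !inE eqxx; exact.
  move=> j; rewrite mem_enum => jJ; rewrite H ?mem_enum ?inE ?jJ ?orbT//.
  by case: eqP => // ji; rewrite -ji jJ in iJ.
have Jt' : (#|(~: (i |: J))%SET| < t)%N.
  move: Jt; rewrite (finset.cardsD1 i) finset.in_setC iJ add1n ltnS; apply: leq_trans.
  by rewrite ltnS; apply: subset_leq_card; apply/fintype.subsetP => j; rewrite !inE negb_or.
rewrite !aE !IHt// !ones_in_setU1// cardsU1 iJ addn1 addn0.
rewrite -EFinD [in RHS](exchangeable_pascal mX _ _ mY YV).
have oJ := ones_in_leq J c.
by congr EFin; congr (V _ _ + V _ _); lia.
Qed.

End subset_atoms.

(** * Condition 2: the Jacobi coefficients *)

Section jacobi_condition.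
Context {R : realType}.
Variables (al1 al0 : R) (n : nat).
Hypotheses (al1_gt0 : 0 < al1) (al0_gt0 : 0 < al0) (n_gt0 : (0 < n)%N).

(** The part of [jacobi_coef] that does not depend on a, once the two Gamma factors in a are reduced
    to their values at a = 0. *)
Definition jacobi_scale : R :=
  Num.sqrt (jacobi_k n al1 al0) * (-1) ^+ n *
  (Gamma (al1 + n%:R) * Gamma (al1 + (al0 + n.-1%:R))
    / (Gamma (al1 + al0 - 1 + 2 * n%:R) * Gamma al1)).

(** With n - 1 >= 0 as the variable, the positivity of arguments such as n + al1 + al0 - 1 is
    linear. *)
Let nE : n%:R = n.-1%:R + 1 :> R. Proof. by rewrite natr1 prednK. Qed.

Lemma jacobi_scale_neq0 : jacobi_scale != 0.
Proof.
have n0 : 0 <= n.-1%:R :> R by [].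
have a1 := al1_gt0; have a0 := al0_gt0.
have G x : 0 < x -> Gamma x != 0 by move=> x0; rewrite gt_eqF// Gamma_gt0.
have k0 : 0 < jacobi_k n al1 al0.
  rewrite /jacobi_k mulr_gt0 ?Beta_gt0// divr_gt0// ?mulr_gt0 ?exprn_gt0
    ?Gamma_gt0 ?ltr0n ?fact_gt0//;
    rewrite nE; lra.
rewrite /jacobi_scale !mulf_neq0 ?invr_neq0 ?mulf_neq0 ?signr_eq0 ?G//.
- by rewrite sqrtr_eq0 -ltNge.
- by rewrite addr_gt0// ltr0n.
- by lra.
- by rewrite nE; lra.
Qed.

(** With x = al0 + n - 1, the Gamma factors in a leave (al1 + x)_a / (al1)_a, the value found in
    [fwd_alt_ratio]. *)
Lemma jacobi_coefE a : (a <= n)%N -> jacobi_coef al1 al0 n a =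
  jacobi_scale * ('C(n, a)%:R * fwd a (alt_ratio al1 (al0 + n.-1%:R))).
Proof.
move=> an; have n0 : 0 <= n.-1%:R :> R by [].
have a1 := al1_gt0; have a0 := al0_gt0.
rewrite fwd_alt_ratio// /jacobi_coef /jacobi_g /jacobi_scale.
have -> : al1 + al0 - 1 + a%:R + n%:R = al1 + (al0 + n.-1%:R) + a%:R.
  by rewrite nE; ring.
have z0 : 0 < al1 + (al0 + n.-1%:R) by lra.
rewrite (addrC a%:R) !(Gamma_rising a)//.
have -> : (-1) ^+ (n - a) = (-1) ^+ n * (-1) ^+ a :> R.
  by rewrite -signr_odd oddB// signr_addb !signr_odd.
have g2 : Gamma (al1 + al0 - 1 + 2 * n%:R) != 0.
  by rewrite gt_eqF// Gamma_gt0// nE; lra.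
have g1 : Gamma al1 != 0 by rewrite gt_eqF// Gamma_gt0.
have r1 := rising_neq0 a al1_gt0.
move: (Gamma al1) (Gamma (al1 + al0 - 1 + _)) (rising al1 a) g1 g2 r1.
move: (rising _ a) (Gamma (al1 + n%:R)) (Gamma _) (Num.sqrt _).
by move=> r G2 G3 k G1 G4 r' G1_neq0 G4_neq0 r'_neq0; field; apply/and3P.
Qed.

Lemma jacobi_conditionP (psi : n.-tuple bool -> R) :
  (exists (k : R) (phi : n.-tuple bool -> R),
     [/\ sym_fun phi,
         forall a : nat, (a <= n)%N ->
           \sum_(0 <= m < a.+1)
             'C(n, m)%:R * 'C(n - m, n - a)%:R * (-1) ^+ (a - m)
             * phi (ones_zeros n m)
           = jacobi_coef al1 al0 n a &
         forall x, psi x = k * phi x]) <->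
  exists f : nat -> R, Xi_rec al1 al0 n f /\ forall x, psi x = f (tuple_ones x).
Proof.
pose r := alt_ratio al1 (al0 + n.-1%:R).
split=> [[k [phi [/sym_funP sphi sys psiE]]]|[f [rf psiE]]].
  exists (fun m => k * jacobi_scale * r m); split.
    move=> m mn; have := alt_ratio_Xi_rec al0 al1_gt0 mn.
    rewrite -/r => E; transitivity (k * jacobi_scale * ((al1 + m%:R) * r m.+1 +
      (al0 + (n.-1 - m)%:R) * r m)); [by ring|by rewrite E mulr0].
  move=> x; rewrite psiE sphi -mulrA; congr (_ * _).
  apply: (@fwd_inj _ n (fun m => phi (ones_zeros n m))
    (fun m => jacobi_scale * r m)); last exact: tuple_ones_leq.
  move=> a an; have := sys a an; rewrite sum_fwd// jacobi_coefE// fwdZ.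
  rewrite mulrCA; apply: mulfI.
  by rewrite pnatr_eq0 -lt0n bin_gt0.
exists (f 0 / jacobi_scale), (fun x => jacobi_scale * r (tuple_ones x)); split.
- apply/sym_funP => x; rewrite tuple_ones_zeros//; exact: tuple_ones_leq.
- move=> a an; rewrite jacobi_coefE// -/r mulrCA -fwdZ -sum_fwd//.
  apply: eq_big_nat => m /andP[_ ma].
  by rewrite tuple_ones_zeros//; lia.
- move=> x; rewrite psiE mulrA divfK ?jacobi_scale_neq0//.
  by rewrite (Xi_rec_alt_ratio al1_gt0 rf)// tuple_ones_leq.
Qed.

End jacobi_condition.

(** * Condition 1: the space Xi_n *)

Section polya.
Context {d : measure_display} {T : measurableType d} {R : realType}.
Variables (P : probability T R) (X : nat -> T -> bool) (al1 al0 : R) (n : nat).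
Hypotheses (mX : forall i, measurable_fun setT (X i)).
Hypotheses (al1_gt0 : 0 < al1) (al0_gt0 : 0 < al0) (n_gt0 : (0 < n)%N).
Hypothesis polyaX : is_polya P X al1 al0.

Let A_gt0 : 0 < al1 + al0. Proof. exact: addr_gt0. Qed.

Notation pol := (polya_prob al1 al0).

Lemma polya_prob_gt0 j l : 0 < pol j l.
Proof. by rewrite /polya_prob divr_gt0 ?mulr_gt0 ?rising_gt0. Qed.

Lemma polya_probSl j l :
  pol j.+1 l = pol j l * (al1 + j%:R) / (al1 + al0 + (j + l)%:R).
Proof.
rewrite /polya_prob addSn !risingSr invfM.
by field; rewrite -natrD rising_neq0// gt_eqF// ltr_wpDr.
Qed.

Lemma polya_probSr j l :
  pol j l.+1 = pol j l * (al0 + l%:R) / (al1 + al0 + (j + l)%:R).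
Proof.
rewrite /polya_prob addnS !risingSr invfM.
by field; rewrite -natrD rising_neq0// gt_eqF// ltr_wpDr.
Qed.

Lemma integral_first_vars (g : n.-tuple bool -> R) b :
  (\int[P]_(w in cyl X b n) (g (first_vars X n w))%:E =
   (g [tuple b i | i < n] * pol (ones b n) (n - ones b n))%:E)%E.
Proof.
have mC := measurable_cyl mX b n.
rewrite EFinM -(polya_exchangeable mX polyaX) -integralZl//; last first.
  exact: (finite_measure_integrable_cst P 1 mC).
apply: eq_integral => w; rewrite inE => Cw; rewrite mule1; congr (g _)%:E.
by apply: eq_from_tnth => i; rewrite !tnth_mktuple Cw.
Qed.

Lemma tuple_ones_mktuple (b : nat -> bool) : tuple_ones [tuple b i | i < n] = ones b n.
Proof. by apply: eq_bigr => i _; rewrite tnth_mktuple. Qed.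

Lemma measurable_first_vars (g : n.-tuple bool -> R) :
  measurable_fun setT (fun w => g (first_vars X n w)).
Proof.
move=> _ B mB; rewrite setTI; apply: (@measurable_saturated _ _ _ X mX (iota 0 n)).
move=> w w' ww'; rewrite /preimage/=.
suff -> : first_vars X n w = first_vars X n w' by [].
by apply: eq_from_tnth => i; rewrite !tnth_mktuple ww'// mem_iota/=.
Qed.

Lemma integrable_first_vars (g : n.-tuple bool -> R) :
  P.-integrable setT (EFin \o (fun w => g (first_vars X n w))).
Proof.
apply: (@probability_bounded_integrable _ _ _ _ _ (\sum_x `|g x|)).
  exact: measurable_first_vars.
by move=> w; rewrite (bigD1 (first_vars X n w))//= lerDl sumr_ge0.
Qed.

Lemma XiP (psi : n.-tuple bool -> R) : Xi P X n psi <->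
  exists f : nat -> R, Xi_rec al1 al0 n f /\ forall x, psi x = f (tuple_ones x).
Proof.
have iE : `I_n.-1 = [set` iota 0 n.-1].
  by apply/seteqP; split=> i /=; rewrite mem_iota.
have aE b : atom X (iota 0 n.-1) b = cyl X b n.-1.
  by apply/seteqP; split=> w H i; [move=> ik; apply: H; rewrite mem_iota|rewrite mem_iota/= => /H].
(* A pattern of length n - 1 with o ones has two extensions, with conditional probabilities
   proportional to al1 + o and al0 + n - 1 - o. *)
have key (f : nat -> R) b : (forall x, psi x = f (tuple_ones x)) ->
    (\int[P]_(w in cyl X b n.-1) (psi (first_vars X n w))%:E =
    (pol (ones b n.-1) (n.-1 - ones b n.-1) / (al1 + al0 + n.-1%:R) *
     ((al1 + (ones b n.-1)%:R) * f (ones b n.-1).+1 +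
      (al0 + (n.-1 - ones b n.-1)%:R) * f (ones b n.-1)))%:E)%E.
  move=> psiE; have ok := ones_leq b n.-1.
  rewrite integral_cylS//; last exact: measurable_first_vars.
  rewrite prednK// !integral_first_vars !psiE !tuple_ones_mktuple.
  have upE v : ones (upd b n.-1 v) n = (ones b n.-1 + v)%N.
    by rewrite -(ones_updS b n.-1 v) prednK.
  rewrite !upE addn1 addn0; set o := ones b n.-1 in ok *.
  have -> : (n - o.+1 = n.-1 - o)%N by lia.
  have -> : (n - o = (n.-1 - o).+1)%N by lia.
  rewrite polya_probSl polya_probSr subnKC// -EFinD; congr EFin; ring.
split=> [[spsi]|[f [rf psiE]]].
  rewrite iE => /(is_cond_exp_atom) [_ H].
  exists (fun m => psi (ones_zeros n m)); split; last exact/sym_funP.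
  (* The pattern with m leading ones tests the recurrence at m; its positive probability can be
     cancelled. *)
  move=> m mn; have := H (fun i => (i < m)%N); rewrite aE.
  rewrite (key (fun m => psi (ones_zeros n m))); last exact/sym_funP.
  rewrite integral0 ones_ltn (minn_idPl _); last by rewrite -ltnS prednK.
  move=> [] /esym/eqP; rewrite mulf_eq0 mulf_eq0 gt_eqF ?polya_prob_gt0//=.
  by rewrite invr_eq0 (gt_eqF (ltr_wpDr _ A_gt0))//= => /eqP.
split.
  apply/sym_funP => x; rewrite !psiE tuple_ones_zeros//; exact: tuple_ones_leq.
rewrite iE; apply: atom_is_cond_exp => //; first exact: iota_uniq.
- exact: integrable_first_vars.
- exact: finite_measure_integrable_cst.
move=> b; rewrite aE (key f)// rf ?mulr0 ?integral0//.
by rewrite -[X in (_ < X)%N](prednK n_gt0) ltnS ones_leq.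
Qed.

End polya.

(** * Condition 3: projections of functionals of eta *)

Section theta_sum.
Context {R : realType}.
Variables (A : R) (n : nat) (w : nat -> nat -> R).
Hypotheses (A_gt0 : 0 < A) (w00 : w 0 0 = 0).

(** What is left of theta^(n,a) when (-1)^a (A+a)_(n-1) is taken out. *)
Definition theta_scale : R := (-1) ^+ n * (A + n%:R + n%:R - 1) / n`!%:R.

Lemma theta_scale_neq0 : (0 < n)%N -> theta_scale != 0.
Proof.
move=> n0; have n1 : 1 <= n%:R :> R by rewrite ler1n.
rewrite /theta_scale !mulf_neq0 ?signr_eq0 ?invr_neq0 ?pnatr_eq0 -?lt0n ?fact_gt0//.
by rewrite gt_eqF//; have := A_gt0; lra.
Qed.

(** The sum on the left starts at a = 1, while splitting along the ones of x needs all subsets;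
    [w00] makes the empty set harmless. *)
Lemma theta_sumE (x : n.-tuple bool) :
  \sum_(1 <= a < n.+1) theta A n a * \sum_(J : {set 'I_n} | #|J| == a)
     w (ones_in J (tnth x)) (#|J| - ones_in J (tnth x)) =
  theta_scale * \sum_(j < n.+1) \sum_(l < n.+1)
    'C(tuple_ones x, j)%:R * 'C(n - tuple_ones x, l)%:R * (-1) ^+ (j + l)
     * rising (A + (j + l)%:R) n.-1 * w j l.
Proof.
pose S := [set i | tnth x i]%SET.
have oS : #|S| = tuple_ones x.
  rewrite -sum1_card /tuple_ones big_mkcond/=; apply: eq_bigr => i _.
  by rewrite inE; case: (tnth x i).
have oI (J : {set 'I_n}) : ones_in J (tnth x) = #|(J :&: S)%SET|.
  rewrite -sum1_card /ones_in [RHS]big_mkcond/= big_mkcond/=.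
  by apply: eq_bigr => i _; rewrite !inE; case: (i \in J); case: (tnth x i).
have oD (J : {set 'I_n}) : (#|J| - ones_in J (tnth x))%N = #|(J :\: S)%SET|.
  by rewrite oI cardsD.
pose G j l := theta_scale * ((-1) ^+ (j + l) * rising (A + (j + l)%:R) n.-1 * w j l).
transitivity (\sum_(J : {set 'I_n}) G #|(J :&: S)%SET| #|(J :\: S)%SET|).
  transitivity (\sum_(1 <= a < n.+1) \sum_(J : {set 'I_n} | #|J| == a)
      G #|(J :&: S)%SET| #|(J :\: S)%SET|).
    apply: eq_big_nat => a /andP[a1 an]; rewrite mulr_sumr.
    apply: eq_bigr => J /eqP Ja; rewrite oD oI /G -/(ones_in _ _).
    have -> : (#|(J :&: S)%SET| + #|(J :\: S)%SET| = a)%N by rewrite cardsID.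
    rewrite thetaE ?a1// /theta_scale.
    have -> : (-1) ^+ (n - a) = (-1) ^+ n * (-1) ^+ a :> R.
      by rewrite -signr_odd oddB// signr_addb !signr_odd.
    by ring.
  rewrite (exchange_big_dep xpredT)//=; apply: eq_bigr => J _.
  have Jn : (#|J| < n.+1)%N by rewrite ltnS (leq_trans (max_card _))// card_ord.
  have [J0|J0] := posnP #|J|.
    rewrite big1_seq; last first.
      by move=> a; rewrite J0 mem_index_iota => /andP[/eqP <-].
    have [K1 K2] : #|(J :&: S)%SET| = 0%N /\ #|(J :\: S)%SET| = 0%N.
      by have := cardsID S J; rewrite J0 => /eqP; rewrite addn_eq0 => /andP[/eqP -> /eqP ->].
    by rewrite K1 K2 /G w00 !mulr0.
  rewrite (eq_bigl (fun a => a == #|J|)); last by move=> a; rewrite eq_sym.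
  by rewrite big_nat1_eq J0 Jn.
rewrite sum_set_split oS mulr_sumr; apply: eq_bigr => j _.
by rewrite mulr_sumr; apply: eq_bigr => l _; rewrite /G; ring.
Qed.

End theta_sum.

Lemma bounded_Lfun2 (d : measure_display) (T : measurableType d) (R : realType)
    (P : probability T R) (f : T -> R) (M : R) :
  measurable_fun setT f -> (forall w, `|f w| <= M) -> f \in Lfun P 2%:E.
Proof.
move=> mf fM; rewrite inE; apply/andP; split; first by rewrite inE.
rewrite inE /= /finite_norm unlock.
apply: poweR_lty.
have : P.-integrable setT (EFin \o (fun w => `|f w| `^ 2)).
  apply: (@probability_bounded_integrable _ _ _ _ _ (M `^ 2)) => [|w].
    apply: (@measurableT_comp _ _ _ _ _ _ (@powR R ^~ 2)) => //.
    exact: measurableT_comp.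
  rewrite ger0_norm ?powR_ge0// ge0_ler_powR// nnegrE//.
  exact: le_trans (fM w).
move=> /integrableP[_]; apply: le_lt_trans; rewrite le_eqVlt; apply/orP; left.
by apply/eqP; apply: eq_integral => w _ /=; congr EFin; rewrite [RHS]ger0_norm ?powR_ge0.
Qed.

Section condition3.
Context {d : measure_display} {T : measurableType d} {R : realType}.
Variables (P : probability T R) (X : nat -> T -> bool) (eta : T -> R).
Variables (al1 al0 : R) (n : nat).
Hypotheses (mX : forall i, measurable_fun setT (X i))
  (meta : measurable_fun setT eta).
Hypotheses (al1_gt0 : 0 < al1) (al0_gt0 : 0 < al0) (n_gt0 : (0 < n)%N).
Hypothesis polyaX : is_polya P X al1 al0.
Hypothesis X_eta : {ae P, forall w, (fun m => psum X m w / m%:R) @ \oo --> eta w}.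

Let A := al1 + al0.
Let A_gt0 : 0 < A. Proof. exact: addr_gt0. Qed.
Let pol := polya_prob al1 al0.
Let XV1 : exchangeable P X (fun=> 1) pol := polya_exchangeable mX polyaX.
Let Xn (i : 'I_n) := X i.

Lemma pol00 : pol 0 0 = 1.
Proof. by rewrite /pol /polya_prob !rising0 mulr1 divr1. Qed.

Lemma exchangeable_expectation (Y : T -> R) V :
  exchangeable P X Y V -> fine ('E_P[Y])%E = V 0 0.
Proof.
move=> YV; have := YV (fun=> true) 0.
rewrite (_ : cyl X _ 0 = setT); last by apply/seteqP; split.
by rewrite /ones big_ord0 sub0n unlock => ->.
Qed.

Section centered.
Variables (Y : T -> R) (V : nat -> nat -> R).
Hypotheses (iY : P.-integrable setT (EFin \o Y)) (YV : exchangeable P X Y V).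

Let EY := fine ('E_P[Y])%E.
Let Yc w := Y w - EY.

(* The conditional expectation of Y - E(Y) given that j ones and l zeros have
   been observed. *)
Definition cond_value j l := (V j l - V 0 0 * pol j l) / pol j l.

Let mY : measurable_fun setT Y.
Proof. by have /integrableP[+ _] := iY => /measurable_EFinP. Qed.

Let YcV : exchangeable P X Yc (fun j l => V j l - V 0 0 * pol j l).
Proof.
rewrite -(exchangeable_expectation YV).
exact: (exchangeable_shift mX XV1).
Qed.

Let mYc : measurable_fun setT Yc.
Proof. exact: measurable_funB. Qed.

Let iYc : P.-integrable setT (EFin \o Yc).
Proof.
rewrite /Yc; have := @integrableB _ _ _ P setT measurableT (EFin \o Y)
  (EFin \o cst EY) iY (finite_measure_integrable_cst P EY measurableT).
by apply: eq_integrable.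
Qed.

Let pol_neq0 j l : pol j l != 0.
Proof. by rewrite gt_eqF// polya_prob_gt0. Qed.

Lemma cond_value00 : cond_value 0 0 = 0.
Proof. by rewrite /cond_value pol00 mulr1 subrr mul0r. Qed.

(** The Pascal relation for the integrals of Y - E(Y), divided by pattern probabilities, whose
    ratios are the Polya transition probabilities. *)
Lemma cond_value_mart j l : (A + (j + l)%:R) * cond_value j l =
  (al1 + j%:R) * cond_value j.+1 l + (al0 + l%:R) * cond_value j l.+1.
Proof.
rewrite {1}/cond_value; have /= -> := exchangeable_pascal mX j l mYc YcV.
rewrite /cond_value; set a := V j.+1 l - _; set b := V j l.+1 - _.
rewrite /pol polya_probSl ?polya_probSr// -/(pol j l).
have Ajl : al1 + al0 + (j + l)%:R != 0 by rewrite gt_eqF// ltr_wpDr.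
have al1j : al1 + j%:R != 0 by rewrite gt_eqF// ltr_wpDr.
have al0l : al0 + l%:R != 0 by rewrite gt_eqF// ltr_wpDr.
rewrite /A natrD in Ajl *; field.
by rewrite Ajl al1j al0l pol_neq0.
Qed.

(** Valid at every w: Z is constant on the atom of w, and that atom has positive probability. *)
Lemma cond_exp_value (J : {set 'I_n}) (Z : T -> R) :
  is_cond_exp P (sigma_of Xn [set` J]) Yc Z ->
  forall w, Z w = cond_value (ones_in J (Xn^~ w)) (#|J| - ones_in J (Xn^~ w)).
Proof.
have -> : [set` J] = [set` enum J].
  by apply/seteqP; split=> i /=; rewrite mem_enum.
move=> /is_cond_exp_atom[Zs ZY] w; have := ZY (Xn^~ w).
rewrite (integral_subset_atom mX mYc YcV).
have -> : (\int[P]_(w' in atom Xn (enum J) (Xn^~ w)) (Z w')%:E =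
    \int[P]_(w' in atom Xn (enum J) (Xn^~ w)) ((Z w)%:E * 1%:E))%E.
  apply: eq_integral => w'; rewrite inE => ww'; rewrite mule1; congr EFin.
  by apply: Zs => i iJ; rewrite ww'.
have mA : measurable (atom Xn (enum J) (Xn^~ w)).
  by apply: measurable_atom => i; exact: mX.
rewrite integralZl//; last exact: (finite_measure_integrable_cst P 1 mA).
rewrite (integral_subset_atom mX _ XV1)// -EFinM => -[ZE].
by rewrite /cond_value -ZE mulfK.
Qed.

Lemma value_cond_exp (J : {set 'I_n}) :
  is_cond_exp P (sigma_of Xn [set` J]) Yc
    (fun w => cond_value (ones_in J (Xn^~ w)) (#|J| - ones_in J (Xn^~ w))).
Proof.
have -> : [set` J] = [set` enum J].
  by apply/seteqP; split=> i /=; rewrite mem_enum.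
have onesE w w' : agree Xn (enum J) w w' -> ones_in J (Xn^~ w) = ones_in J (Xn^~ w').
  by move=> ww'; apply: eq_bigr => i iJ; rewrite ww'// mem_enum.
pose g (x : n.-tuple bool) := cond_value (ones_in J (tnth x)) (#|J| - ones_in J (tnth x)).
have gE w : cond_value (ones_in J (Xn^~ w)) (#|J| - ones_in J (Xn^~ w)) =
    g (first_vars X n w).
  have E : ones_in J (Xn^~ w) = ones_in J (tnth (first_vars X n w)).
    by apply: eq_bigr => i _; rewrite tnth_mktuple.
  by rewrite /g E.
apply: atom_is_cond_exp => //.
- by move=> i; exact: mX.
- exact: enum_uniq.
- have := integrable_first_vars P mX g; apply: eq_integrable => // w _ /=.
  by rewrite gE.
- by move=> w w' /onesE ->.
move=> c; rewrite (integral_subset_atom mX mYc YcV).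
have mA : measurable (atom Xn (enum J) c).
  by apply: measurable_atom => i; exact: mX.
transitivity (\int[P]_(w in atom Xn (enum J) c)
  ((cond_value (ones_in J c) (#|J| - ones_in J c))%:E * 1%:E))%E.
  apply: eq_integral => w; rewrite inE => wc; rewrite mule1.
  have -> // : ones_in J (Xn^~ w) = ones_in J c.
  by apply: eq_bigr => i iJ; rewrite wc// mem_enum.
rewrite integralZl//; last exact: (finite_measure_integrable_cst P 1 mA).
by rewrite (integral_subset_atom mX _ XV1)// -EFinM /cond_value divfK.
Qed.

Definition projection_fun m : R :=
  theta_scale A n * hoeffding_sum al1 al0 cond_value n m (n - m).

Lemma projection_fun_rec : Xi_rec al1 al0 n projection_fun.
Proof.
move=> m mn; have mE : (m + (n.-1 - m) = n.-1)%N by lia.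
have := hoeffding_sum_rec cond_value_mart n_gt0 mE.
have -> : (n.-1 - m).+1 = (n - m)%N by lia.
rewrite /projection_fun (_ : n - m.+1 = n.-1 - m)%N; last by lia.
by move=> E; rewrite !(mulrCA _ (theta_scale A n)) -mulrDr E mulr0.
Qed.

Lemma theta_sum_projection (Z : {set 'I_n} -> T -> R) w :
  (forall J, Z J w = cond_value (ones_in J (Xn^~ w)) (#|J| - ones_in J (Xn^~ w))) ->
  \sum_(1 <= a < n.+1) theta A n a * \sum_(J : {set 'I_n} | #|J| == a) Z J w =
  projection_fun (tuple_ones (first_vars X n w)).
Proof.
move=> ZE; rewrite /projection_fun -(theta_sumE A_gt0 cond_value00).
apply: eq_bigr => a _; congr (_ * _); apply: eq_bigr => J _; rewrite ZE.
have -> // : ones_in J (Xn^~ w) = ones_in J (tnth (first_vars X n w)).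
by apply: eq_bigr => i _; rewrite tnth_mktuple.
Qed.

End centered.

(** A cylinder has positive probability, so it is not contained in a null set. This turns the almost
    sure identity of condition 3 into one for every vector. *)
Lemma ae_cyl (Q : T -> Prop) b k : {ae P, forall w, Q w} ->
  exists2 w, cyl X b k w & Q w.
Proof.
move=> [N [mN N0 sN]]; apply: contrapT => H.
have CN : cyl X b k `<=` N.
  by move=> w Cw; apply: sN => Qw; apply: H; exists w.
have mC := measurable_cyl mX b k.
have := XV1 b k; rewrite null_set_integral//.
  by move=> -[] /eqP; rewrite lt_eqF// polya_prob_gt0.
by apply/eqP; rewrite -measure_le0 -N0 le_measure// inE.
Qed.

Definition projection_condition (psi : n.-tuple bool -> R) :=
  exists (Y : T -> R) (Z : {set 'I_n} -> T -> R),
    [/\ L2_functional P eta Y,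
        forall J : {set 'I_n},
          is_cond_exp P (sigma_of Xn [set` J])
            (fun w => Y w - fine ('E_P[Y])%E) (Z J) &
        {ae P, forall w,
          psi (first_vars X n w) =
          \sum_(1 <= a < n.+1) theta A n a *
            \sum_(J : {set 'I_n} | #|J| == a) Z J w}].

Lemma projection_condition_rec psi : projection_condition psi ->
  exists f : nat -> R, Xi_rec al1 al0 n f /\ forall x, psi x = f (tuple_ones x).
Proof.
move=> [Y [Z [[[f mf YE] Y2] ZP psiZ]]].
have iY : P.-integrable setT (EFin \o Y).
  apply/Lfun1_integrable; apply: Lfun_subset12 Y2.
  by rewrite fin_num_measure.
have [V YV] : exists V, exchangeable P X Y V.
  by move: iY; rewrite YE => iY; exact: (exchangeable_comp_eta mX meta X_eta XV1).
exists (projection_fun V); split; first exact: projection_fun_rec iY YV.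
move=> x; pose b i := nth false x i.
have [w Cw psiw] := ae_cyl b n psiZ.
have <- : first_vars X n w = x.
  by apply: eq_from_tnth => i; rewrite tnth_mktuple Cw// (tnth_nth false).
rewrite psiw; apply: theta_sum_projection => J.
exact: (cond_exp_value iY YV (ZP J)).
Qed.

Let clampn (kappa : R) w := kappa * clamp (eta w) ^+ n.

Let clampnV kappa : exchangeable P X (clampn kappa)
  (fun j l => kappa * pol (j + n)%N l).
Proof.
move=> b k; have mC := measurable_cyl mX b k.
rewrite EFinM -(exchangeable_clampX mX meta X_eta XV1 n) -integralZl//.
by apply: integrableS (integrable_clampX P meta n).
Qed.

(* At m = 0 the n-th difference of the polynomial part vanishes and that of
   1 / (A + n - 1 + l) does not. *)
Let projection_clampn kappa :
  projection_fun (fun j l => kappa * pol (j + n)%N l) 0 =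
  kappa * (theta_scale A n * (rising al1 n * (rising 1 n / rising (A + n.-1%:R) n.+1))).
Proof.
rewrite /projection_fun mulrCA; congr (_ * _).
rewrite /hoeffding_sum big_ord_recl [X in _ + X]big1 ?addr0; last first.
  by move=> i _; apply: big1 => l _; rewrite bin0n/= !mul0r.
(* Only j = 0 is left. The quotient of [pol n l] by [pol 0 l] is (al1)_n / (A+l)_n, and multiplying
   by (A+l)_(n-1) leaves (al1)_n / (A+l+n-1); centering contributes the polynomial part. *)
transitivity (\sum_(l < n.+1) (kappa * (-1) ^+ n * (rising al1 n *
   ('C(n, l)%:R * (-1) ^+ (n - l) * (rising (A + n.-1%:R + l%:R) 1)^-1)
   - pol n 0 * ('C(n, l)%:R * (-1) ^+ (n - l) * rising (A + l%:R) n.-1)))).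
  apply: eq_bigr => -[l /=]; rewrite ltnS => ln _.
  rewrite subn0 bin0 mul1r add0n /cond_value.
  have -> : (-1) ^+ (n - l) = (-1) ^+ n * (-1) ^+ l :> R.
    by rewrite -signr_odd oddB// signr_addb !signr_odd.
  have l0 : 0 <= l%:R :> R by [].
  have n10 : 0 <= n.-1%:R :> R by [].
  have al1' := al1_gt0; have al0' := al0_gt0.
  have rn : rising (A + l%:R) n = rising (A + l%:R) n.-1 * (A + l%:R + n.-1%:R).
    by rewrite -{1}(prednK n_gt0) risingSr.
  have r1 : rising (A + n.-1%:R + l%:R) 1 = A + l%:R + n.-1%:R.
    by rewrite risingSr rising0 mul1r addr0; ring.
  rewrite r1 /pol /polya_prob !rising0 !add0n addn0 -/A (addnC n l) risingD rn.
  have e2 : (-1) ^+ n * (-1) ^+ n = 1 :> R by rewrite -expr2 sqrr_sign.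
  have q1 : rising (A + l%:R) n.-1 != 0 by rewrite rising_neq0// ltr_wpDr.
  have q2 : A + l%:R + n.-1%:R != 0 by rewrite gt_eqF// /A; lra.
  have q3 := rising_neq0 l A_gt0; have q4 := rising_neq0 l al0_gt0.
  have q5 := rising_neq0 n A_gt0.
  transitivity (((-1) ^+ n * (-1) ^+ n) * (kappa * (-1) ^+ l * 'C(n, l)%:R * (rising al1 n
    / (A + l%:R + n.-1%:R) - rising al1 n / rising A n * rising (A + l%:R) n.-1))).
    by rewrite e2; field; rewrite q1 q2 q3 q4 q5.
  by field; rewrite q2 q5.
rewrite -mulr_sumr sumrB -!mulr_sumr.
rewrite -/(fwd n (fun i => (rising (A + n.-1%:R + i%:R) 1)^-1)).
rewrite -/(fwd n (fun i => rising (A + i%:R) n.-1)).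
rewrite fwd_rising ?prednK// mulr0 subr0 fwd_rising_inv; last by rewrite ltr_wpDr.
have e2 : (-1) ^+ n * (-1) ^+ n = 1 :> R by rewrite -expr2 sqrr_sign.
rewrite add1n; set t := rising _ n.+1.
transitivity (((-1) ^+ n * (-1) ^+ n) * (kappa * (rising al1 n * (rising 1 n / t)))).
  ring.
by rewrite e2 mul1r.
Qed.

Lemma rec_projection_condition psi :
  (exists f : nat -> R, Xi_rec al1 al0 n f /\ forall x, psi x = f (tuple_ones x)) ->
  projection_condition psi.
Proof.
move=> [f [rf psiE]].
pose F := theta_scale A n * (rising al1 n * (rising 1 n / rising (A + n.-1%:R) n.+1)).
have F0 : F != 0.
  have z0 : 0 < A + n.-1%:R by rewrite ltr_wpDr.
  apply: mulf_neq0; first exact: theta_scale_neq0.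
  apply: mulf_neq0; first exact: rising_neq0.
  by rewrite mulf_neq0 ?invr_neq0 ?rising_neq0.
(* [F] is the value at m = 0 of the projection of eta^n, so kappa matches the two solutions of the
   recurrence at 0, hence everywhere. *)
pose kappa := f 0 / F.
have mc : measurable_fun setT (clampn kappa).
  apply: measurable_funM => //.
  apply: (@measurableT_comp _ _ _ _ _ _ (fun x => clamp x ^+ n)) => //.
  exact: measurable_clampX.
have bc w : `|clampn kappa w| <= `|kappa|.
  have /andP[c0 c1] := clampX_itv n (eta w).
  by rewrite normrM ler_piMr// ger0_norm.
have iY := probability_bounded_integrable P mc bc.
have YV := clampnV kappa.
pose W j l := kappa * pol (j + n)%N l.
exists (clampn kappa), (fun J w => cond_value W
  (ones_in J (Xn^~ w)) (#|J| - ones_in J (Xn^~ w))); split.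
- split; last exact: bounded_Lfun2 mc bc.
  exists (fun x => kappa * clamp x ^+ n) => //.
  by apply: measurable_funM => //; exact: measurable_clampX.
- by move=> J; exact: (value_cond_exp iY YV).
- apply: aeW => w; have /(_ (fun J => erefl)) := theta_sum_projection
    (V := W) (Z := fun J w => cond_value W (ones_in J (Xn^~ w))
    (#|J| - ones_in J (Xn^~ w))) (w := w).
  move=> /= ->.
  rewrite psiE (Xi_rec_alt_ratio al1_gt0 rf) ?tuple_ones_leq//.
  rewrite [RHS](Xi_rec_alt_ratio al1_gt0 (projection_fun_rec iY YV)) ?tuple_ones_leq//.
  by rewrite /W projection_clampn -/F /kappa divfK.
Qed.

End condition3.

Theorem proposition8 (d : measure_display) (T : measurableType d)
    (R : realType) (P : probability T R) (al1 al0 : R)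
    (X : nat -> {RV P >-> bool}) (eta : {RV P >-> R})
    (n : nat) (psi : n.-tuple bool -> R) :
  0 < al1 -> 0 < al0 ->
  is_polya P X al1 al0 ->
  {ae P, forall w,
    (fun m : nat => (\sum_(i < m) (X i w)%:R) / m%:R) @ \oo --> eta w} ->
  (0 < n)%N ->
  [<-> Xi P X n psi;
       exists (k : R) (phi : n.-tuple bool -> R),
         [/\ sym_fun phi,
             forall a : nat, (a <= n)%N ->
               \sum_(0 <= m < a.+1)
                 'C(n, m)%:R * 'C(n - m, n - a)%:R * (-1) ^+ (a - m)
                 * phi (ones_zeros n m)
               = jacobi_coef al1 al0 n a &
             forall x, psi x = k * phi x];
       exists (Y : T -> R) (Z : {set 'I_n} -> T -> R),
         [/\ L2_functional P eta Y,
             forall J : {set 'I_n},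
               is_cond_exp P (sigma_of (fun i : 'I_n => X i) [set` J])
                 (fun w => Y w - fine ('E_P[Y])%E) (Z J) &
             {ae P, forall w,
               psi (first_vars X n w) =
               \sum_(1 <= a < n.+1) theta (al1 + al0) n a *
                 \sum_(J : {set 'I_n} | #|J| == a) Z J w}]].
Proof.
move=> al1_gt0 al0_gt0 polyaX X_eta n_gt0.
have mX i : measurable_fun setT (X i) by [].
have meta : measurable_fun setT eta by [].
have c1 := XiP mX al1_gt0 al0_gt0 n_gt0 polyaX psi.
have c2 := jacobi_conditionP al1_gt0 al0_gt0 n_gt0 psi.
have c31 := projection_condition_rec mX meta al1_gt0 al0_gt0 n_gt0 polyaX X_eta (psi := psi).
have c13 := rec_projection_condition mX meta al1_gt0 al0_gt0 n_gt0 polyaX X_eta (psi := psi).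
tfae.
- by move=> /c1 /c2.
- by move=> /c2 /c13.
- by move=> /c31 /c1.
Qed.
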